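(* Let $G$ be a group with a finite presentation $\langle S\mid R\rangle$ which is reduced and all of whose relators $r\in R$ are nonempty words. Let $\tilde{\Sigma}_G$ be the space of nonempty chains of cells of the Cayley complex of $\langle S\mid R\rangle$, with its topology and $G$-action as defined in the context, and let $\tilde{\Sigma}_G/G$ be the orbit space with the quotient topology. Then $G\cong \pi_1(\tilde{\Sigma}_G/G)$, and $$|\tilde{\Sigma}_G/G| = 1+3|S|+\sum_{r\in R}\bigl(4\,\mathrm{length}(r)+1\bigr).$$
   Context: Presentations. $S$ is a nonempty finite set, $F_S$ is the free group on $S$, $R\subseteq F_S$ is finite, and $\varphi:F_S\to G$ is a surjective homomorphism whose kernel is the normal closure of $R$. For $w,w'\in F_S$ (or their images in $G$), $w=_G w'$ means $\varphi(w)=\varphi(w')$. Each $r\in R$ is a (reduced) word with $\mathrm{length}(r)$ letters in $S\cup S^{-1}$; $r[i]$ denotes its $i$-th letter for $1\le i\le \mathrm{length}(r)$, $r[0]=e$ is the identity, and $r[i,j]=r[i]r[i+1]\cdots r[j]$ for $0\le i\le j\le \mathrm{length}(r)$. Words are also interpreted as elements of $G$ via $\varphi$. The presentation is reduced if $s\ne_G e$ for every $s\in S$ and, for every $r\in R$ and $0\le i\le j\le\mathrm{length}(r)$ with $(i,j)\neq(0,0)$, $r[i,j]=_G e$ only when $i\in\{0,1\}$ and $j=\mathrm{length}(r)$. Cayley complex. $X_G$ is the 2-dimensional CW complex with 0-cells the elements of $G$; a 1-cell $(g,s)$ for each $(g,s)\in G\times S$, connecting the vertices $g$ and $gs$; and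 a 2-cell $(g,r)$ for each $(g,r)\in G\times R$, attached along the closed edge path passing through the vertices $g\,r[0,0], g\,r[0,1],\dots, g\,r[0,\mathrm{length}(r)]$, whose $(i+1)$-st edge, from $g\,r[0,i]$ to $g\,r[0,i+1]$, is $(g\,r[0,i],r[i+1])$. If $r[i+1]=s^{-1}$ with $s\in S$, this means the 1-cell $(g\,r[0,i+1],s)$ traversed backwards. The set of cells is $\Sigma_G= G\sqcup(G\times S)\sqcup(G\times R)$. It is partially ordered by $x\preccurlyeq y$ iff $x=y$ or $x$ is in the boundary of $y$: the cells in the boundary of $(g,s)$ are $g$ and $gs$, and the cells in the boundary of $(g,r)$ are the vertices and 1-cells of its attaching path. The space $\tilde{\Sigma}_G$. $\tilde{\Sigma}_G$ is the set of nonempty $\preccurlyeq$-chains in $\Sigma_G$, topologized by the base $\{\mathrm{star}(\sigma):\sigma\in\tilde{\Sigma}_G\}$, where $\mathrm{star}(\sigma)=\{\lambda\in\tilde{\Sigma}_G:\sigma\subseteq\lambda\}$. Action. $G$ acts on $\Sigma_G$ by $g\cdot h=gh$, $g\cdot(h,s)=(gh,s)$, $g\cdot(h,r)=(gh,r)$, and on $\tilde{\Sigma}_G$ by $g\sigma=\{gx:x\in\sigma\}$. *)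

(* Defs.v *)
From HB Require Import structures.
From mathcomp Require Import all_boot all_order all_algebra.
From mathcomp Require Import finmap generic_quotient lra.
From mathcomp Require Import all_classical all_reals all_analysis homotopy.

Set Implicit Arguments.
Unset Strict Implicit.
Unset Printing Implicit Defensive.

Import Order.TTheory GRing.Theory Num.Theory.
Import numFieldNormedType.Exports.

(* [groupType] only asks for a choice structure on the carrier, so it covers
   arbitrary, possibly infinite, groups. *)
Definition isomorphic (G H : groupType) : Prop :=
  exists f : {multiplicative G -> H}, bijective f.

(* [(s, false)] stands for the letter s and [(s, true)] for s^-1. *)
Definition letter (S : Type) : Type := (S * bool)%type.

Definition inv_letter (S : Type) (a : letter S) : letter S := (a.1, ~~ a.2).

Section Words.
Variable S : choiceType.
Implicit Types (a b : letter S) (u v w : seq (letter S)).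

Definition reduced_word : pred (seq (letter S)) :=
  sorted (fun a b => b != inv_letter a).

Definition cons_letter a w : seq (letter S) :=
  if w is b :: w' then if b == inv_letter a then w' else a :: w else [:: a].

Definition reduce : seq (letter S) -> seq (letter S) := foldr cons_letter [::].

Lemma inv_letterK : involutive (@inv_letter S).
Proof. by case=> s b; rewrite /inv_letter /= negbK. Qed.

Lemma reduced_cons_letter a w : reduced_word w -> reduced_word (cons_letter a w).
Proof.
rewrite /reduced_word; case: w => //= b w; case: eqP => [_|/eqP nba] pw /=.
  exact: path_sorted pw.
by rewrite nba.
Qed.

Lemma reduced_foldr w u : reduced_word u -> reduced_word (foldr cons_letter u w).
Proof. by move=> ru; elim: w => //= a w; apply: reduced_cons_letter. Qed.

Lemma reduce_reduced w : reduced_word (reduce w).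
Proof. exact: reduced_foldr. Qed.

Lemma reduce_id w : reduced_word w -> reduce w = w.
Proof.
rewrite /reduced_word; elim: w => //= a w IH pw.
rewrite IH; last exact: path_sorted pw.
by case: w pw {IH} => //= b w /andP[/negbTE ->].
Qed.

Lemma cons_letterK a u : reduced_word u ->
  cons_letter (inv_letter a) (cons_letter a u) = u.
Proof.
case: u => [|b u] /=; first by rewrite inv_letterK eqxx.
case: eqP => [-> |_ _] /=; last by rewrite inv_letterK eqxx.
by case: u => //= c u /andP[/negbTE ->].
Qed.

Lemma foldr_cons_letter a w u : reduced_word u ->
  foldr cons_letter u (cons_letter a w) = cons_letter a (foldr cons_letter u w).
Proof.
case: w => //= b w ru; case: eqP => //= ->.
by rewrite -{1}(inv_letterK a) cons_letterK //; apply: reduced_foldr.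
Qed.

Lemma foldr_reduce w u : reduced_word u ->
  foldr cons_letter u (reduce w) = foldr cons_letter u w.
Proof. by move=> ru; elim: w => //= a w IH; rewrite foldr_cons_letter ?IH. Qed.

Lemma reduce_catr u v : reduce (u ++ reduce v) = reduce (u ++ v).
Proof.
by rewrite /reduce !foldr_cat -/(reduce _) reduce_id // reduce_reduced.
Qed.

Lemma reduce_catl u v : reduce (reduce u ++ v) = reduce (u ++ v).
Proof.
by rewrite /reduce !foldr_cat -/(reduce _) foldr_reduce // reduce_reduced.
Qed.

Definition inv_word w : seq (letter S) := rev (map (@inv_letter S) w).

Lemma inv_wordK : involutive inv_word.
Proof.
by move=> w; rewrite /inv_word map_rev revK -map_comp map_id_in // => a _; exact: inv_letterK.
Qed.

Lemma reduced_inv_word w : reduced_word w -> reduced_word (inv_word w).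
Proof.
rewrite /reduced_word /inv_word rev_sorted sorted_map.
apply: sub_sorted => a b /=.
by apply: contra => /eqP/(can_inj inv_letterK) ->; rewrite inv_letterK.
Qed.

Lemma reduce_inv_word w : reduce (inv_word w ++ w) = [::].
Proof.
elim: w => //= a w IH; rewrite /inv_word /= rev_cons -/(inv_word w).
rewrite -cats1 -catA /= -reduce_catr /=.
by rewrite cons_letterK ?reduce_reduced // reduce_catr.
Qed.

Record free_group := FreeGroup {
  fword :> seq (letter S);
  fwordP : reduced_word fword }.

HB.instance Definition _ := [isSub for fword].
HB.instance Definition _ := [Choice of free_group by <:].

Definition free_one : free_group := @FreeGroup [::] isT.
Definition free_mul (x y : free_group) : free_group :=
  FreeGroup (reduce_reduced (x ++ y)).
Definition free_inv (x : free_group) : free_group :=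
  FreeGroup (reduced_inv_word (fwordP x)).

Lemma free_mulA : associative free_mul.
Proof.
by move=> x y z; apply: val_inj => /=; rewrite reduce_catr reduce_catl catA.
Qed.
Lemma free_mul1 : left_id free_one free_mul.
Proof. by move=> x; apply: val_inj => /=; rewrite reduce_id // fwordP. Qed.
Lemma free_mulr1 : right_id free_one free_mul.
Proof. by move=> x; apply: val_inj => /=; rewrite cats0 reduce_id // fwordP. Qed.
Lemma free_mulV : left_inverse free_one free_inv free_mul.
Proof. by move=> x; apply: val_inj => /=; rewrite reduce_inv_word. Qed.
Lemma free_mulrV : right_inverse free_one free_inv free_mul.
Proof.
by move=> x; apply: val_inj => /=; rewrite -{1}(inv_wordK x) reduce_inv_word.
Qed.

HB.instance Definition _ := isGroup.Build free_group
  free_mulA free_mul1 free_mulr1 free_mulV free_mulrV.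

Definition free_letter a : free_group := @FreeGroup [:: a] isT.
Definition free_gen (s : S) : free_group := free_letter (s, false).

End Words.

Local Open Scope group_scope.
Local Open Scope classical_set_scope.

Record normal_subgroup (G : groupType) (N : set G) : Prop := NormalSubgroup {
  normal1 : N 1;
  normalM : forall x y, N x -> N y -> N (x * y);
  normalV : forall x, N x -> N x^-1;
  normalJ : forall x y, N x -> N (x ^ y) }.

Definition normal_closure (G : groupType) (A : set G) : set G :=
  smallest (@normal_subgroup G) A.

Section Presentations.
Context {S : finType} {G : groupType}.
Variables (R : {fset free_group S}) (phi : {multiplicative free_group S -> G}).

Definition is_presentation : Prop :=
  range phi = [set: G] /\
  [set w | phi w = 1] = normal_closure [set` R].

(* [nth_letter r i] is the i-th letter of r (counted from 1, with value 1 at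
   i = 0), and [subword r i j] is r[i,j]; both are elements of the free group. *)
Definition nth_letter (r : free_group S) (i : nat) : free_group S :=
  nth 1 (1 :: [seq free_letter a | a <- r]) i.

Definition subword (r : free_group S) (i j : nat) : free_group S :=
  \prod_(i <= k < j.+1) nth_letter r k.

Definition is_reduced_presentation : Prop :=
  (forall s, phi (free_gen s) <> 1) /\
  (forall r i j, r \in R -> (i <= j <= size r)%N -> (i, j) <> (0%N, 0%N) ->
     phi (subword r i j) = 1 -> (i = 0%N \/ i = 1%N) /\ j = size r).

End Presentations.

Local Open Scope quotient_scope.

Section CayleyComplex.
Context {S : finType} {G : groupType}.
Variables (R : {fset free_group S}) (phi : {multiplicative free_group S -> G}).

Inductive cell : Type :=
  | Vertex of G
  | Edge of G & S
  | Face of G & R.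

Definition path_vertex (g : G) (r : free_group S) (i : nat) : G :=
  g * phi (subword r 0 i).

(* [onth r i] is the (i+1)-st letter of r.  A letter s^-1 is traversed along
   the edge labelled s that starts at the end of the step. *)
Inductive in_boundary : cell -> cell -> Prop :=
  | EdgeSource g s : in_boundary (Vertex g) (Edge g s)
  | EdgeTarget g s : in_boundary (Vertex (g * phi (free_gen s))) (Edge g s)
  | FaceVertex g (r : R) i : (i <= size (fsval r))%N ->
      in_boundary (Vertex (path_vertex g (fsval r) i)) (Face g r)
  | FaceEdge g (r : R) i s : onth (fsval r) i = Some (s, false) ->
      in_boundary (Edge (path_vertex g (fsval r) i) s) (Face g r)
  | FaceEdgeInv g (r : R) i s : onth (fsval r) i = Some (s, true) ->
      in_boundary (Edge (path_vertex g (fsval r) i.+1) s) (Face g r).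

Definition cell_le (x y : cell) : Prop := x = y \/ in_boundary x y.

Definition act_cell (g : G) (x : cell) : cell :=
  match x with
  | Vertex h => Vertex (g * h)
  | Edge h s => Edge (g * h) s
  | Face h r => Face (g * h) r
  end.

Lemma act_cell1 x : act_cell 1 x = x.
Proof. by case: x => *; rewrite /= mul1g. Qed.

Lemma act_cellM g h x : act_cell (g * h) x = act_cell g (act_cell h x).
Proof. by case: x => *; rewrite /= mulgA. Qed.

Lemma act_in_boundary g x y :
  in_boundary x y -> in_boundary (act_cell g x) (act_cell g y).
Proof.
case=> *; rewrite /= ?/path_vertex ?mulgA;
  solve [exact: EdgeSource | exact: EdgeTarget | exact: FaceVertex
        | exact: FaceEdge | exact: FaceEdgeInv].
Qed.

Lemma act_cell_le g x y : cell_le x y -> cell_le (act_cell g x) (act_cell g y).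
Proof. by case=> [->|xy]; [left|right; exact: act_in_boundary]. Qed.

Record chain := Chain {
  cells :> set cell;
  cells_nonempty : cells !=set0;
  cells_total : total_on cells cell_le }.

Lemma chain_eq (sigma tau : chain) : cells sigma = cells tau -> sigma = tau.
Proof.
case: sigma tau => [A A0 At] [B B0 Bt] /= AB; rewrite -AB in B0 Bt *.
by congr Chain; exact: Prop_irrelevance.
Qed.

HB.instance Definition _ := gen_eqMixin chain.
HB.instance Definition _ := gen_choiceMixin chain.

Program Definition vertex_chain : chain := @Chain [set Vertex 1] _ _.
Next Obligation. by exists (Vertex 1). Qed.
Next Obligation. by move=> _ _ -> ->; left; left. Qed.

HB.instance Definition _ := isPointed.Build chain vertex_chain.

Definition star (sigma : chain) : set chain :=
  [set lambda : chain | (sigma : set cell) `<=` lambda].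

Lemma star_cover : \bigcup_(sigma in [set: chain]) star sigma = setT.
Proof. by apply/seteqP; split => // sigma _; exists sigma. Qed.

Lemma star_join (sigma tau lambda : chain) :
  [set: chain] sigma -> [set: chain] tau -> star sigma lambda -> star tau lambda ->
  exists k, [/\ [set: chain] k, star k lambda & star k `<=` star sigma `&` star tau].
Proof.
move=> _ _ sl tl; exists lambda; split => // k lk.
by split; apply: subset_trans lk.
Qed.

HB.instance Definition _ := isBaseTopological.Build chain star_cover star_join.

Program Definition act_chain (g : G) (sigma : chain) : chain :=
  @Chain (act_cell g @` sigma) _ _.
Next Obligation.
by move=> g sigma; have [x sx] := cells_nonempty sigma; exists (act_cell g x), x.
Qed.
Next Obligation.
move=> g sigma _ _ [x sx <-] [y sy <-].
by case: (cells_total sx sy) => xy; [left|right]; exact: act_cell_le.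
Qed.

Lemma act_chainM g h sigma :
  act_chain (g * h) sigma = act_chain g (act_chain h sigma).
Proof.
apply: chain_eq => /=; rewrite image_comp.
by apply: eq_imagel => x _; rewrite act_cellM.
Qed.

Lemma act_chain1 sigma : act_chain 1 sigma = sigma.
Proof.
apply: chain_eq => /=.
by under eq_imagel do rewrite act_cell1; rewrite image_id.
Qed.

Definition same_orbit : rel chain :=
  fun sigma tau => `[< exists g, tau = act_chain g sigma >].

Lemma same_orbit_refl : reflexive same_orbit.
Proof. by move=> sigma; apply/asboolP; exists 1; rewrite act_chain1. Qed.

Lemma same_orbit_sym : symmetric same_orbit.
Proof.
by move=> sigma tau; apply/asboolP/asboolP => -[g ->]; exists g^-1;
  rewrite -act_chainM mulVg act_chain1.
Qed.

Lemma same_orbit_trans : transitive same_orbit.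
Proof.
move=> tau sigma rho /asboolP[g ->] /asboolP[h ->]; apply/asboolP.
by exists (h * g); rewrite act_chainM.
Qed.

Definition same_orbit_equiv : equiv_rel chain :=
  EquivRel same_orbit same_orbit_refl same_orbit_sym same_orbit_trans.

Definition orbit_space : Type := quotient_topology {eq_quot same_orbit_equiv}.
HB.instance Definition _ := Topological.on orbit_space.

End CayleyComplex.

Arguments Vertex {S G R} g.
Arguments Edge {S G R} g s.
Arguments Face {S G R} g r.

Local Open Scope ring_scope.

Definition unit_interval (R : realType) : Type := set_type `[0 : R, 1]%classic.

Section UnitInterval.
Variable R : realType.
Local Notation I := (unit_interval R).

HB.instance Definition _ := Topological.copy I (set_type `[0 : R, 1]%classic).

Lemma clamp_subproof (x : R) : Num.max 0 (Num.min x 1) \in `[0 : R, 1]%classic.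
Proof. by rewrite inE /= in_itv /= le_max lexx ge_max ler01 ge_min lexx orbT. Qed.

Definition clamp (x : R) : I :=
  @exist R (fun y => y \in `[0, 1]%classic) _ (clamp_subproof x).

Definition ival (t : I) : R := set_val t.

Lemma ival_ge0 t : 0 <= ival t.
Proof. by have := set_valP t; rewrite /= in_itv /= => /andP[]. Qed.
Lemma ival_le1 t : ival t <= 1.
Proof. by have := set_valP t; rewrite /= in_itv /= => /andP[]. Qed.

Lemma ival_inj : injective ival.
Proof. exact: val_inj. Qed.

Lemma clampE (x : R) : 0 <= x -> x <= 1 -> ival (clamp x) = x.
Proof. by move=> x0 x1; rewrite /ival set_valE /= min_l // max_r. Qed.

Lemma clampK : cancel ival clamp.
Proof. by move=> t; apply: ival_inj; rewrite clampE ?ival_ge0 ?ival_le1. Qed.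

Lemma clamp_le0 (x : R) : x <= 0 -> clamp x = clamp 0.
Proof.
move=> x0; apply: ival_inj; rewrite [RHS]clampE // /ival set_valE /=.
by rewrite min_l ?max_l // (le_trans x0).
Qed.

Lemma ival_continuous : continuous ival.
Proof. exact: initial_continuous. Qed.

Lemma clamp_continuous : continuous clamp.
Proof.
apply: (@continuous_comp_initial _ R R set_val).
rewrite (_ : _ \o _ = fun x : R => Num.max 0 (Num.min x 1)); last first.
  by apply/funext => x; rewrite /= set_valE.
move=> x; apply: (@continuous_max R R (cst 0) (fun x => Num.min x 1)); first exact: cvg_cst.
by apply: (@continuous_min R R id (cst 1)); [exact: cvg_id|exact: cvg_cst].
Qed.

Lemma clamp01_neq : clamp 0 != clamp 1.
Proof.
by apply/eqP => /(congr1 ival); rewrite !clampE // => /esym/eqP; rewrite oner_eq0.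
Qed.

HB.instance Definition _ := isBiPointed.Build I clamp01_neq.

Lemma ival0 : ival zero = 0. Proof. exact: clampE. Qed.
Lemma ival1 : ival one = 1. Proof. exact: clampE. Qed.
Lemma clamp0 : clamp 0 = zero. Proof. by []. Qed.
Lemma clamp1 : clamp 1 = one. Proof. by []. Qed.

Lemma glue_continuous (T X : topologicalType) (c : T -> R) (f g : T -> X) :
  continuous c -> continuous f -> continuous g ->
  (forall t, c t = 0 -> f t = g t) ->
  continuous (fun t => if c t <= 0 then f t else g t).
Proof.
move=> cc cf cg fg; apply/continuous_subspace_setT.
have -> : [set: T] = c @^-1` [set x | x <= 0] `|` c @^-1` [set x | 0 <= x].
  by apply/seteqP; split => // t _; apply/orP; exact: le_total.
apply: withinU_continuous.
- by apply: preimage_closed; [move=> ? _; exact: cc|exact: closed_le].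
- by apply: preimage_closed; [move=> ? _; exact: cc|exact: closed_ge].
- apply: (@subspace_eq_continuous _ _ _ f); last exact: continuous_subspaceT.
  by move=> t /set_mem c0; rewrite /from_subspace ifT.
- apply: (@subspace_eq_continuous _ _ _ g); last exact: continuous_subspaceT.
  move=> t /set_mem c0; rewrite /from_subspace; case: ifP => // c0'.
  by apply/esym/fg/le_anti; rewrite c0 c0'.
Qed.

End UnitInterval.

Section Homotopy.
Context {R : realType} {X : topologicalType}.
Local Notation I := (unit_interval R).
Local Notation path x y := {path I from x to y}.
Implicit Types x y z : X.

Definition path_homotopy x y (p q : path x y) (H : I * I -> X) : Prop :=
  [/\ continuous H,
      forall t, H (t, zero) = p t,
      forall t, H (t, one) = q t,
      forall s, H (zero, s) = x &
      forall s, H (one, s) = y].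

Definition path_homotopic x y : rel (path x y) :=
  fun p q => `[< exists H, path_homotopy p q H >].

Section Concat.
Variables (x y z : X) (p : path x y) (q : path y z).

Definition concat (t : I) : X :=
  if ival t <= 2^-1 then p (clamp (2 * ival t)) else q (clamp (2 * ival t - 1)).

End Concat.

Section Reverse.
Variables (x y : X) (p : path x y).

Definition reverse (t : I) : X := p (clamp (1 - ival t)).

End Reverse.

Lemma comp_continuous (T U V : topologicalType) (f : T -> U) (g : U -> V) :
  continuous f -> continuous g -> continuous (fun t => g (f t)).
Proof. by move=> cf cg t; apply: (@continuous_comp _ _ _ f); [exact: cf|exact: cg]. Qed.

Lemma continuous_clamp (T : topologicalType) (f : T -> R) :
  continuous f -> continuous (fun t => clamp (f t)).
Proof.
by move=> cf t; apply: (@continuous_comp _ _ _ f); [exact: cf|exact: clamp_continuous].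
Qed.

Lemma continuous_ival (T : topologicalType) (f : T -> I) :
  continuous f -> continuous (fun t => ival (f t)).
Proof.
by move=> cf t; apply: (@continuous_comp _ _ _ f); [exact: cf|exact: ival_continuous].
Qed.

Lemma continuous_affine (T : topologicalType) (f : T -> R) (a b : R) :
  continuous f -> continuous (fun t => a * f t + b).
Proof.
move=> cf t; apply: (@cvgD _ R^o); last exact: cvg_cst.
by apply: (@cvgM R); [exact: cvg_cst|exact: cf].
Qed.

Lemma pair_continuous (T U V : topologicalType) (f : T -> U) (g : T -> V) :
  continuous f -> continuous g -> continuous (fun t => (f t, g t)).
Proof.
by move=> cf cg t; apply: (@cvg_pair _ _ _ _ (nbhs (f t)) (nbhs (g t))); [exact: cf|exact: cg].
Qed.

Lemma fst_continuous (T U : topologicalType) : continuous (@fst T U).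
Proof. by move=> tu; exact: cvg_fst. Qed.

Lemma snd_continuous (T U : topologicalType) : continuous (@snd T U).
Proof. by move=> tu; exact: cvg_snd. Qed.

Lemma double_continuous (a : R) : continuous (fun t : I => clamp (2 * ival t + a)).
Proof. exact/continuous_clamp/continuous_affine/ival_continuous. Qed.

Lemma concat_continuous x y z (p : path x y) (q : path y z) : continuous (concat p q).
Proof.
rewrite (_ : concat p q = fun t => if 1 * ival t + (- 2^-1) <= 0 then
    p (clamp (2 * ival t + 0)) else q (clamp (2 * ival t - 1))); last first.
  by apply/funext => t; rewrite /concat mul1r subr_le0 addr0.
apply: glue_continuous.
- exact/continuous_affine/ival_continuous.
- by move=> t; apply: (@continuous_comp _ _ _ (fun t => clamp (2 * ival t + 0)));
    [exact: double_continuous|exact: cts_fun].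
- by move=> t; apply: (@continuous_comp _ _ _ (fun t => clamp (2 * ival t - 1)));
    [exact: double_continuous|exact: cts_fun].
- move=> t t0; have -> : 2 * ival t + 0 = 1 by lra.
  have -> : 2 * ival t - 1 = 0 by lra.
  by rewrite clamp0 clamp1 path_zero path_one.
Qed.

Lemma concat_zero x y z (p : path x y) (q : path y z) : concat p q zero = x.
Proof. by rewrite /concat ival0 mulr0 clamp0 path_zero invr_ge0 ler0n. Qed.

Lemma concat_one x y z (p : path x y) (q : path y z) : concat p q one = z.
Proof.
rewrite /concat ival1 ifF; last by apply/negbTE; rewrite -ltNge; lra.
by rewrite (_ : 2 * 1 - 1 = 1) ?clamp1 ?path_one //; lra.
Qed.

HB.instance Definition _ x y z (p : path x y) (q : path y z) :=
  isContinuous.Build I X (concat p q) (@concat_continuous _ _ _ p q).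
HB.instance Definition _ x y z (p : path x y) (q : path y z) :=
  isPath.Build I X x z (concat p q) (concat_zero p q) (concat_one p q).

Lemma concat_le x y z (p : path x y) (q : path y z) t :
  ival t <= 2^-1 -> concat p q t = p (clamp (2 * ival t)).
Proof. by rewrite /concat => ->. Qed.

Lemma concat_gt x y z (p : path x y) (q : path y z) t :
  2^-1 < ival t -> concat p q t = q (clamp (2 * ival t - 1)).
Proof. by rewrite /concat ltNge => /negbTE ->. Qed.

Lemma rev_continuous : continuous (fun t : I => clamp (1 - ival t)).
Proof.
rewrite (_ : (fun t => _) = fun t : I => clamp (-1 * ival t + 1)).
  exact/continuous_clamp/continuous_affine/ival_continuous.
by apply/funext => t; rewrite mulN1r addrC.
Qed.

Lemma reverse_continuous x y (p : path x y) : continuous (reverse p).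
Proof.
by move=> t; apply: (@continuous_comp _ _ _ (fun t => clamp (1 - ival t)));
  [exact: rev_continuous|exact: cts_fun].
Qed.

Lemma reverse_zero x y (p : path x y) : reverse p zero = y.
Proof. by rewrite /reverse ival0 subr0 clamp1 path_one. Qed.

Lemma reverse_one x y (p : path x y) : reverse p one = x.
Proof. by rewrite /reverse ival1 subrr clamp0 path_zero. Qed.

HB.instance Definition _ x y (p : path x y) :=
  isContinuous.Build I X (reverse p) (@reverse_continuous _ _ p).
HB.instance Definition _ x y (p : path x y) :=
  isPath.Build I X y x (reverse p) (reverse_zero p) (reverse_one p).

Lemma reparam_homotopic x y (p q : path x y) (a : I -> X) (phi psi : I -> R) :
  continuous a -> continuous phi -> continuous psi ->
  phi zero = psi zero -> phi one = psi one ->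
  p =1 (fun t => a (clamp (phi t))) -> q =1 (fun t => a (clamp (psi t))) ->
  path_homotopic p q.
Proof.
move=> ca cphi cpsi e0 e1 pE qE; apply/asboolP.
exists (fun ts => a (clamp (phi ts.1 + ival ts.2 * (psi ts.1 - phi ts.1)))).
split.
- move=> ts; apply: (@continuous_comp _ _ _
    (fun ts : I * I => clamp (phi ts.1 + ival ts.2 * (psi ts.1 - phi ts.1))));
    last exact: ca.
  have cphi1 : continuous (fun ts : I * I => phi ts.1).
    by move=> us; apply: (@continuous_comp _ _ _ fst); [exact: cvg_fst|exact: cphi].
  have cpsi1 : continuous (fun ts : I * I => psi ts.1).
    by move=> us; apply: (@continuous_comp _ _ _ fst); [exact: cvg_fst|exact: cpsi].
  have c2 : continuous (fun ts : I * I => ival ts.2).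
    by apply: continuous_ival => us; exact: cvg_snd.
  apply: continuous_clamp => {}ts.
  apply: (@cvgD _ R^o); first exact: cphi1.
  apply: (@cvgM R); first exact: c2.
  by apply: (@cvgB _ R^o); [exact: cpsi1|exact: cphi1].
- by move=> t /=; rewrite ival0 mul0r addr0 pE.
- by move=> t /=; rewrite ival1 mul1r addrC subrK qE.
- by move=> s /=; rewrite e0 subrr mulr0 addr0 -e0 -[RHS](path_zero (s := p)) pE.
- by move=> s /=; rewrite e1 subrr mulr0 addr0 -e1 -[RHS](path_one (s := p)) pE.
Qed.

Lemma path_homotopic_refl x y : reflexive (@path_homotopic x y).
Proof.
move=> p; apply: (@reparam_homotopic _ _ _ _ p (@ival R) (@ival R)) => //.
- exact: cts_fun.
- exact: ival_continuous.
- exact: ival_continuous.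
- by move=> t; rewrite clampK.
- by move=> t; rewrite clampK.
Qed.

Lemma path_homotopic_sym x y : symmetric (@path_homotopic x y).
Proof.
suff sym p q : path_homotopic p q -> @path_homotopic x y q p.
  by move=> p q; apply/idP/idP; exact: sym.
move=> /asboolP[H [cH Hp Hq Hx Hy]]; apply/asboolP.
exists (fun ts => H (ts.1, clamp (1 - ival ts.2))); split => //=.
- move=> ts; apply: (@continuous_comp _ _ _
    (fun ts : I * I => (ts.1, clamp (1 - ival ts.2)))); last exact: cH.
  move: ts; apply: pair_continuous; first exact: fst_continuous.
  apply: (@comp_continuous _ _ _ snd (fun s => clamp (1 - ival s))).
    exact: snd_continuous.
  exact: rev_continuous.
- by move=> t; rewrite ival0 subr0 clamp1.
- by move=> t; rewrite ival1 subrr clamp0.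
Qed.

Lemma glue_homotopy (T Y : topologicalType) (f g : T * I -> Y) :
  continuous f -> continuous g -> (forall t, f (t, one) = g (t, zero)) ->
  continuous (fun ts : T * I => if ival ts.2 <= 2^-1
    then f (ts.1, clamp (2 * ival ts.2)) else g (ts.1, clamp (2 * ival ts.2 - 1))).
Proof.
move=> cf cg fg.
have cs a : continuous (fun ts : T * I => (ts.1, clamp (2 * ival ts.2 + a))).
  apply: pair_continuous; first exact: fst_continuous.
  by apply/continuous_clamp/continuous_affine/continuous_ival; exact: snd_continuous.
rewrite (_ : (fun _ => _) = fun ts : T * I => if 1 * ival ts.2 + (- 2^-1) <= 0
  then f (ts.1, clamp (2 * ival ts.2 + 0))
  else g (ts.1, clamp (2 * ival ts.2 - 1))); last first.
  by apply/funext => ts; rewrite mul1r subr_le0 addr0.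
apply: glue_continuous.
- by apply/continuous_affine/continuous_ival => ts; exact: cvg_snd.
- by move=> ts; apply: (@continuous_comp _ _ _
    (fun ts : T * I => (ts.1, clamp (2 * ival ts.2 + 0)))); [exact: cs|exact: cf].
- by move=> ts; apply: (@continuous_comp _ _ _
    (fun ts : T * I => (ts.1, clamp (2 * ival ts.2 - 1)))); [exact: cs|exact: cg].
- move=> [t s] /= s0; have -> : 2 * ival s + 0 = 1 by lra.
  have -> : 2 * ival s - 1 = 0 by lra.
  by rewrite clamp0 clamp1.
Qed.

Lemma path_homotopic_trans x y : transitive (@path_homotopic x y).
Proof.
move=> q p r /asboolP[H [cH Hp Hq Hx Hy]] /asboolP[K [cK Kq Kr Kx Ky]].
apply/asboolP; eexists; split.
- by apply: (glue_homotopy cH cK) => t; rewrite Hq Kq.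
- by move=> t /=; rewrite ival0 mulr0 clamp0 Hp invr_ge0 ler0n.
- move=> t /=; rewrite ival1 ifF; last by apply/negbTE; rewrite -ltNge; lra.
  by rewrite (_ : 2 * 1 - 1 = 1) ?clamp1 //; lra.
- by move=> s /=; rewrite Hx Kx if_same.
- by move=> s /=; rewrite Hy Ky if_same.
Qed.

Lemma concat_homotopic x y z (p p' : path x y) (q q' : path y z) :
  path_homotopic p p' -> path_homotopic q q' ->
  path_homotopic (concat p q) (concat p' q').
Proof.
move=> /asboolP[H [cH Hp Hp' Hx Hy]] /asboolP[K [cK Kq Kq' Ky Kz]].
pose sw (ts : I * I) : I * I := (ts.2, ts.1).
have csw : continuous sw.
  by apply: pair_continuous; [exact: snd_continuous|exact: fst_continuous].
have cHs : continuous (H \o sw).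
  by move=> ts; apply: (@continuous_comp _ _ _ sw); [exact: csw|exact: cH].
have cKs : continuous (K \o sw).
  by move=> ts; apply: (@continuous_comp _ _ _ sw); [exact: csw|exact: cK].
apply/asboolP; exists ((fun ts : I * I => if ival ts.2 <= 2^-1
    then (H \o sw) (ts.1, clamp (2 * ival ts.2))
    else (K \o sw) (ts.1, clamp (2 * ival ts.2 - 1))) \o sw); split.
- move=> ts; apply: (@continuous_comp _ _ _ sw); first exact: csw.
  by apply: glue_homotopy => // t; rewrite /sw /= Hy Ky.
- by move=> t; rewrite /sw /= /concat Hp Kq.
- by move=> t; rewrite /sw /= /concat Hp' Kq'.
- by move=> s; rewrite /sw /= ival0 mulr0 clamp0 Hx invr_ge0 ler0n.
- move=> s; rewrite /sw /= ival1 ifF; last by apply/negbTE; rewrite -ltNge; lra.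
  by rewrite (_ : 2 * 1 - 1 = 1) ?clamp1 ?Kz //; lra.
Qed.

Lemma reverse_homotopic x y (p p' : path x y) :
  path_homotopic p p' -> path_homotopic (reverse p) (reverse p').
Proof.
move=> /asboolP[H [cH Hp Hp' Hx Hy]]; apply/asboolP.
exists (fun ts => H (clamp (1 - ival ts.1), ts.2)); split => /=.
- move=> ts; apply: (@continuous_comp _ _ _
    (fun ts : I * I => (clamp (1 - ival ts.1), ts.2))); last exact: cH.
  move: ts; apply: pair_continuous; last exact: snd_continuous.
  apply: (@comp_continuous _ _ _ fst (fun s => clamp (1 - ival s))).
    exact: fst_continuous.
  exact: rev_continuous.
- by move=> t; rewrite Hp.
- by move=> t; rewrite Hp'.
- by move=> s; rewrite ival0 subr0 clamp1.
- by move=> s; rewrite ival1 subrr clamp0.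
Qed.

Lemma continuous_ivalaffine (a b : R) : continuous (fun t : I => a * ival t + b).
Proof. exact/continuous_affine/ival_continuous. Qed.

Lemma concatA_homotopic x y z w (p : path x y) (q : path y z) (r : path z w) :
  path_homotopic (concat p (concat q r)) (concat (concat p q) r).
Proof.
pose psi (t : I) : R :=
  Num.max (2^-1 * ival t + 0) (Num.max (1 * ival t + (- 4^-1)) (2 * ival t - 1)).
apply: (@reparam_homotopic _ _ _ _ (concat (concat p q) r) psi (@ival R)).
- exact: cts_fun.
- move=> t; apply: (@continuous_max R I); first exact: continuous_ivalaffine.
  by apply: (@continuous_max R I); exact: continuous_ivalaffine.
- exact: ival_continuous.
- by rewrite /psi ival0 !mulr0 !add0r max_l // ge_max; lra.
- by rewrite /psi ival1 (@max_r _ _ (1 * 1 - 4^-1)) ?max_r; lra.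
- move=> t; have t0 := ival_ge0 t; have t1 := ival_le1 t.
  have [h|h] := lerP (ival t) (2^-1).
    have psiE : psi t = 2^-1 * ival t.
      by rewrite /psi max_l addr0 // ge_max; apply/andP; split; lra.
    have e1 : ival (clamp (psi t)) = 2^-1 * ival t by rewrite psiE clampE //; lra.
    have e2 : ival (clamp (2 * ival (clamp (psi t)))) = ival t.
      by rewrite e1 clampE; lra.
    rewrite /= concat_le // concat_le; last by rewrite e1; lra.
    by rewrite /= concat_le ?e2.
  have [k|k] := lerP (ival t) (3 / 4).
    have psiE : psi t = ival t - 4^-1.
      by rewrite /psi mul1r max_r ?max_l // ?le_max; lra.
    have e1 : ival (clamp (psi t)) = ival t - 4^-1 by rewrite psiE clampE //; lra.
    have e2 : ival (clamp (2 * ival (clamp (psi t)))) = 2 * ival t - 2^-1.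
      by rewrite e1 clampE; lra.
    have e3 : ival (clamp (2 * ival t - 1)) = 2 * ival t - 1 by rewrite clampE; lra.
    rewrite /= concat_gt //= concat_le ?e3; last lra.
    rewrite [RHS]concat_le; last by rewrite e1; lra.
    rewrite /= concat_gt ?e2; last lra.
    by congr (q (clamp _)); lra.
  have psiE : psi t = 2 * ival t - 1.
    by rewrite /psi (@max_r _ _ (1 * ival t - 4^-1)) ?max_r //; lra.
  have e1 : ival (clamp (psi t)) = 2 * ival t - 1 by rewrite psiE clampE //; lra.
  have e3 : ival (clamp (2 * ival t - 1)) = 2 * ival t - 1 by rewrite clampE; lra.
  rewrite /= concat_gt //= concat_gt ?e3; last lra.
  by rewrite [RHS]concat_gt ?e1; last lra.
- by move=> t; rewrite clampK.
Qed.

Lemma concat_cst_l x y (p : path x y) : path_homotopic (concat (cst x : path x x) p) p.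
Proof.
pose psi (t : I) : R := Num.max (0 * ival t + 0) (2 * ival t - 1).
apply: (@reparam_homotopic _ _ _ _ p psi (@ival R)).
- exact: cts_fun.
- by move=> t; apply: (@continuous_max R I); exact: continuous_ivalaffine.
- exact: ival_continuous.
- by rewrite /psi ival0 max_l; lra.
- by rewrite /psi ival1 max_r; lra.
- move=> t; rewrite /= /concat /psi; have [h|h] := lerP (ival t) (2^-1).
    by rewrite max_l ?mul0r ?addr0 ?clamp0 ?path_zero //; lra.
  by rewrite max_r //; lra.
- by move=> t; rewrite clampK.
Qed.

Lemma concat_cst_r x y (p : path x y) : path_homotopic (concat p (cst y : path y y)) p.
Proof.
pose psi (t : I) : R := Num.min (2 * ival t + 0) (0 * ival t + 1).
apply: (@reparam_homotopic _ _ _ _ p psi (@ival R)).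
- exact: cts_fun.
- by move=> t; apply: (@continuous_min R I); exact: continuous_ivalaffine.
- exact: ival_continuous.
- by rewrite /psi ival0 min_l; lra.
- by rewrite /psi ival1 min_r; lra.
- move=> t; rewrite /= /concat /psi; have [h|h] := lerP (ival t) (2^-1).
    by rewrite min_l ?addr0 //; lra.
  by rewrite min_r ?mul0r ?add0r ?clamp1 ?path_one //; lra.
- by move=> t; rewrite clampK.
Qed.

Lemma concat_reverse_r x y (p : path x y) :
  path_homotopic (concat p (reverse p)) (cst x : path x x).
Proof.
pose psi (t : I) : R := Num.min (2 * ival t + 0) (- 2 * ival t + 2).
apply: (@reparam_homotopic _ _ _ _ p psi (fun=> 0)).
- exact: cts_fun.
- by move=> t; apply: (@continuous_min R I); exact: continuous_ivalaffine.
- exact: cst_continuous.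
- by rewrite /psi ival0 min_l; lra.
- by rewrite /psi ival1 min_r; lra.
- move=> t; have t0 := ival_ge0 t; have t1 := ival_le1 t.
  rewrite /= /concat /psi; have [h|h] := lerP (ival t) (2^-1).
    by rewrite min_l ?addr0 //; lra.
  rewrite min_r; last lra.
  rewrite /= /reverse clampE; [|lra..].
  by congr (p (clamp _)); lra.
- by move=> t; rewrite clamp0 path_zero.
Qed.

Lemma concat_reverse_l x y (p : path x y) :
  path_homotopic (concat (reverse p) p) (cst y : path y y).
Proof.
pose psi (t : I) : R := Num.max (- 2 * ival t + 1) (2 * ival t - 1).
apply: (@reparam_homotopic _ _ _ _ p psi (fun=> 1)).
- exact: cts_fun.
- by move=> t; apply: (@continuous_max R I); exact: continuous_ivalaffine.
- exact: cst_continuous.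
- by rewrite /psi ival0 max_l; lra.
- by rewrite /psi ival1 max_r; lra.
- move=> t; have t0 := ival_ge0 t; have t1 := ival_le1 t.
  rewrite /= /concat /psi; have [h|h] := lerP (ival t) (2^-1).
    rewrite max_l; last lra.
    rewrite /= /reverse clampE; [|lra..].
    by congr (p (clamp _)); lra.
  by rewrite max_r //; lra.
- by move=> t; rewrite clamp1 path_one.
Qed.

Definition homotopy_equiv x y : equiv_rel (path x y) :=
  EquivRel (@path_homotopic x y) (@path_homotopic_refl x y)
    (@path_homotopic_sym x y) (@path_homotopic_trans x y).

End Homotopy.

(* Loops at x up to homotopy relative to the endpoints; the group law is
   concatenation, [p] * [q] = [concat p q] (lemma [pi1_mulE]). *)
Definition fundamental_group (R : realType) (X : topologicalType) (x : X) : Type :=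
  {eq_quot @homotopy_equiv R X x x}.

Section FundamentalGroup.
Variables (R : realType) (X : topologicalType) (x : X).
Local Notation loop := {path (unit_interval R) from x to x}.
Local Notation pi1 := (fundamental_group R x).

HB.instance Definition _ := Choice.copy pi1 {eq_quot @homotopy_equiv R X x x}.
HB.instance Definition _ :=
  EqQuotient.copy pi1 {eq_quot @homotopy_equiv R X x x}.

Definition homotopy_class (p : loop) : pi1 := \pi p.

Lemma homotopy_classP (p q : loop) :
  homotopy_class p = homotopy_class q <-> path_homotopic p q.
Proof.
by split => [/eqquotP|h]; last exact/eqquotP.
Qed.

Lemma homotopy_class_repr (a : pi1) : homotopy_class (repr a) = a.
Proof. exact: reprK. Qed.

Lemma repr_homotopy_class (p : loop) : path_homotopic (repr (homotopy_class p)) p.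
Proof. by apply/homotopy_classP; rewrite homotopy_class_repr. Qed.

Definition pi1_one : pi1 := homotopy_class (cst x : loop).
Definition pi1_mul (a b : pi1) : pi1 := homotopy_class (concat (repr a) (repr b)).
Definition pi1_inv (a : pi1) : pi1 := homotopy_class (reverse (repr a)).

Lemma pi1_mulE p q :
  pi1_mul (homotopy_class p) (homotopy_class q) = homotopy_class (concat p q).
Proof.
by apply/homotopy_classP; apply: concat_homotopic; exact: repr_homotopy_class.
Qed.

Lemma pi1_invE p : pi1_inv (homotopy_class p) = homotopy_class (reverse p).
Proof.
by apply/homotopy_classP; apply: reverse_homotopic; exact: repr_homotopy_class.
Qed.

Lemma pi1_mulA : associative pi1_mul.
Proof.
move=> a b c; rewrite -(homotopy_class_repr a) -(homotopy_class_repr b).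
rewrite -(homotopy_class_repr c) !pi1_mulE.
by apply/homotopy_classP; exact: concatA_homotopic.
Qed.

Lemma pi1_mul1 : left_id pi1_one pi1_mul.
Proof.
move=> a; rewrite -(homotopy_class_repr a) pi1_mulE.
by apply/homotopy_classP; exact: concat_cst_l.
Qed.

Lemma pi1_mulr1 : right_id pi1_one pi1_mul.
Proof.
move=> a; rewrite -(homotopy_class_repr a) pi1_mulE.
by apply/homotopy_classP; exact: concat_cst_r.
Qed.

Lemma pi1_mulV : left_inverse pi1_one pi1_inv pi1_mul.
Proof.
move=> a; rewrite -(homotopy_class_repr a) pi1_invE pi1_mulE.
by apply/homotopy_classP; exact: concat_reverse_l.
Qed.

Lemma pi1_mulrV : right_inverse pi1_one pi1_inv pi1_mul.
Proof.
move=> a; rewrite -(homotopy_class_repr a) pi1_invE pi1_mulE.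
by apply/homotopy_classP; exact: concat_reverse_r.
Qed.

HB.instance Definition _ := isGroup.Build pi1
  pi1_mulA pi1_mul1 pi1_mulr1 pi1_mulV pi1_mulrV.

End FundamentalGroup.

(* Main.v *)
Require Import Defs.
From HB Require Import structures.
From mathcomp Require Import all_boot all_order all_algebra.
From mathcomp Require Import finmap generic_quotient lra.
From mathcomp Require Import all_classical all_reals all_analysis homotopy.

Set Implicit Arguments.
Unset Strict Implicit.
Unset Printing Implicit Defensive.

Import Order.TTheory GRing.Theory Num.Theory.
Import numFieldNormedType.Exports.

(** The orbit space is a finite space whose topology is that of an order: the
    orbit of a chain [sigma] specializes to the orbits of the chains containing
    [sigma], and those form its smallest neighbourhood ([specializesP],
    [orbit_space_alexandrov]).  A chain has at most one cell of each dimension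
    and the group acts freely on cells, so a chain has at most one translate
    inside a given star ([act_chain_uniq]): the chains form a covering of the
    orbit space with deck group [G].

    From loops to [G].  Comparing chains with chosen representatives of their
    orbits turns the covering into a cocycle [deck] on pairs of comparable
    orbits.  Along a continuous map from a square such a cocycle has flat
    sections ([flat_square]), because it has them locally and two of them
    differ by a constant on a connected overlap.  Hence transport along a path
    depends only on the homotopy class, which defines [holonomy], a functor
    from the fundamental groupoid to [G].

    From words to loops.  A point jumps continuously to every point that it
    specializes to, and these steps generate the fundamental groupoid
    ([path_class_ind]).  If a vertex [v] lies below a chain [sigma], adding [v]
    to [sigma] gives a two-step path from the base point to the orbit of
    [sigma], its spoke.  Two vertices below [sigma] give a loop, the turn from
    one spoke to the other, which is the same for every larger or smaller chain
    that both vertices lie below ([turn_sub]).  A turn at an edge is trivial or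
    the loop [edge_loop s] of its label, up to inversion.  A turn at a face
    can be moved to the edges of its boundary, where it spells the part of the
    relator between the two vertices ([turn_face]).  So the edge loops generate
    the fundamental group ([all_spelled]), and since the boundary of a face
    closes up, relators spell trivial loops ([relator_loop]).  The holonomy of
    the loop spelled by a word is, up to one fixed conjugation, the value of
    the word in [G] ([holonomy_word]).  It is therefore onto, and a loop of
    trivial holonomy is spelled by a word in the normal closure of the
    relators, so it is trivial.

    The count.  Each orbit contains exactly one chain whose cell of highest
    dimension is based at 1.  Reducedness says that the two ends of an edge
    differ ([corner_neq]), that a face of length n has n distinct vertices
    ([corner_uniq]) and, as relators are reduced words, n distinct edges
    ([side_inj]).  Besides the single orbit of vertices, an edge contributes
    itself alone or with one of its two ends, and a face contributes itself
    alone or with a vertex, with an edge, or with an edge and one of its ends,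
    which is 1 + n + n + 2n. *)

(** * The fundamental groupoid *)

Section PathClasses.
Local Open Scope quotient_scope.
Variables (K : realType) (X : topologicalType).
Local Notation I := (unit_interval K).
Implicit Types x y z : X.

(** Homotopy classes between two arbitrary endpoints: with equal endpoints this type,
    and [path_cat], [path_inv] and [path_id] below, are convertible to
    [fundamental_group] and its group operations. *)
Definition path_class x y : Type := {eq_quot @homotopy_equiv K X x y}.

Definition pclass x y (p : {path I from x to y}) : path_class x y := \pi p.
Definition path_cat x y z (a : path_class x y) (b : path_class y z) : path_class x z :=
  pclass (concat (repr a) (repr b)).
Definition path_inv x y (a : path_class x y) : path_class y x :=
  pclass (reverse (repr a)).
Definition path_id x : path_class x x := pclass (cst x : {path I from x to x}).

Lemma pclassP x y (p q : {path I from x to y}) :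
  pclass p = pclass q <-> path_homotopic p q.
Proof. by split => [/eqquotP|h]; last exact/eqquotP. Qed.

Lemma pclass_repr x y (a : path_class x y) : pclass (repr a) = a.
Proof. exact: reprK. Qed.

Lemma repr_pclass x y (p : {path I from x to y}) : path_homotopic (repr (pclass p)) p.
Proof. by apply/pclassP; rewrite pclass_repr. Qed.

Lemma eq_pclass x y (p q : {path I from x to y}) : p =1 q -> pclass p = pclass q.
Proof. by move=> /path_eqP ->. Qed.

Lemma path_catE x y z (p : {path I from x to y}) (q : {path I from y to z}) :
  path_cat (pclass p) (pclass q) = pclass (concat p q).
Proof. by apply/pclassP; apply: concat_homotopic; exact: repr_pclass. Qed.

Lemma path_invE x y (p : {path I from x to y}) : path_inv (pclass p) = pclass (reverse p).
Proof. by apply/pclassP; apply: reverse_homotopic; exact: repr_pclass. Qed.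

Lemma path_catA x y z w (a : path_class x y) (b : path_class y z) (c : path_class z w) :
  path_cat a (path_cat b c) = path_cat (path_cat a b) c.
Proof.
rewrite -(pclass_repr a) -(pclass_repr b) -(pclass_repr c) !path_catE.
by apply/pclassP; exact: concatA_homotopic.
Qed.

Lemma path_cat1p x y (a : path_class x y) : path_cat (path_id x) a = a.
Proof.
by rewrite -(pclass_repr a) path_catE; apply/pclassP; exact: concat_cst_l.
Qed.

Lemma path_catp1 x y (a : path_class x y) : path_cat a (path_id y) = a.
Proof.
by rewrite -(pclass_repr a) path_catE; apply/pclassP; exact: concat_cst_r.
Qed.

Lemma path_catpV x y (a : path_class x y) : path_cat a (path_inv a) = path_id x.
Proof.
by rewrite -(pclass_repr a) path_invE path_catE; apply/pclassP; exact: concat_reverse_r.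
Qed.

Lemma path_catVp x y (a : path_class x y) : path_cat (path_inv a) a = path_id y.
Proof.
by rewrite -(pclass_repr a) path_invE path_catE; apply/pclassP; exact: concat_reverse_l.
Qed.

Lemma path_catK x y z (a : path_class x y) (b : path_class y z) :
  path_cat (path_cat a b) (path_inv b) = a.
Proof. by rewrite -path_catA path_catpV path_catp1. Qed.

Lemma path_catVK x y z (a : path_class x y) (b : path_class z y) :
  path_cat (path_cat a (path_inv b)) b = a.
Proof. by rewrite -path_catA path_catVp path_catp1. Qed.

Lemma path_Kcat x y z (a : path_class x y) (b : path_class y z) :
  path_cat (path_inv a) (path_cat a b) = b.
Proof. by rewrite path_catA path_catVp path_cat1p. Qed.

Lemma path_inv_unique x y (a : path_class x y) (b : path_class y x) :
  path_cat a b = path_id x -> path_inv a = b.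
Proof. by move=> ab; rewrite -[RHS](path_Kcat a) ab path_catp1. Qed.

Lemma path_invK x y (a : path_class x y) : path_inv (path_inv a) = a.
Proof. by apply: path_inv_unique; rewrite path_catVp. Qed.

Lemma path_inv_cat x y z (a : path_class x y) (b : path_class y z) :
  path_inv (path_cat a b) = path_cat (path_inv b) (path_inv a).
Proof. by apply: path_inv_unique; rewrite path_catA path_catK path_catpV. Qed.

Lemma path_inv1 x : path_inv (path_id x) = path_id x.
Proof. by apply: path_inv_unique; rewrite path_cat1p. Qed.

End PathClasses.

(** * Steps along the specialization order *)

Section Specialization.
Local Open Scope classical_set_scope.
Local Open Scope ring_scope.
Variables (K : realType) (X : topologicalType).
Local Notation I := (unit_interval K).
Local Notation pc := (path_class K).
Implicit Types x y z : X.

(** The specialization preorder.  On the orbit space it is induced by inclusion of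
    chains, see [specializesP]. *)
Definition specializes x y : Prop := forall A : set X, nbhs x A -> A y.

Lemma specializes_refl x : specializes x x.
Proof. by move=> A; exact: nbhs_singleton. Qed.

Lemma specializes_trans y x z : specializes x y -> specializes y z -> specializes x z.
Proof. by move=> xy yz A /nbhs_interior/xy/yz. Qed.

(** Each neighbourhood of [z] contains every [p t], so continuity is at stake only
    where [f] is positive, and that is an open condition. *)
Lemma jump_continuous (T : topologicalType) (f : T -> K) (z : X) (p : T -> X) :
  continuous f -> (forall t, 0 <= f t) -> continuous p -> (forall t, specializes z (p t)) ->
  continuous (fun t => if f t == 0 then z else p t).
Proof.
move=> cf f0 cp zp t A; rewrite nbhs_simpl /=; case: eqP => [ft0 zA|/eqP ft0 pA].
  apply: filterS filterT => u _ /=; case: ifP => _; last exact: zp zA.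
  exact: nbhs_singleton.
have ft1 : 0 < f t by rewrite lt_neqAle eq_sym ft0 f0.
have fu : \forall u \near t, 0 < f u.
  by apply: (cf t [set u | 0 < u]); apply: open_nbhs_nbhs; split => //; exact: open_gt.
near=> u => /=; rewrite ifF; first by near: u; exact: cp.
by apply/negbTE; rewrite gt_eqF //; near: u.
Unshelve. all: by end_near. Qed.

Section Jump.
Variables (x y : X) (xy : specializes x y).

Definition jump (t : I) : X := if ival t == 0 then x else y.

Lemma jump_cts : continuous jump.
Proof.
apply: jump_continuous; [exact: ival_continuous|exact: ival_ge0| |by []].
exact: cst_continuous.
Qed.

Lemma jump0 : jump zero = x. Proof. by rewrite /jump ival0 eqxx. Qed.
Lemma jump1 : jump one = y. Proof. by rewrite /jump ival1 oner_eq0. Qed.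

Definition step : pc x y := pclass (mk_path jump_cts jump0 jump1).

End Jump.

Lemma clamp_eq0 (u : K) : (ival (clamp u) == 0) = (u <= 0).
Proof.
have [u0|u0] := lerP u 0; first by rewrite clamp_le0 // ival0 eqxx.
apply/negbTE; rewrite gt_eqF // /ival set_valE /=.
by rewrite lt_max lt_min u0 ltr01 orbT.
Qed.

(** A path that stays above [z] can be shortened from its start: at stage [s] jump
    from [z] straight to the point of parameter [s] and follow the rest of the path.
    This is continuous because neighbourhoods of [z] contain the whole path. *)
Lemma step_cat z x y (zx : specializes z x) (zy : specializes z y)
    (p : {path I from x to y}) :
  (forall t, specializes z (p t)) -> path_cat (step zx) (pclass p) = step zy.
Proof.
move=> zp; rewrite path_catE; apply/pclassP/asboolP.
exists (fun ts : I * I => if ival ts.1 == 0 then z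
  else p (clamp (Num.max (2 * ival ts.1 + (- 1)) (ival ts.2)))).
have c1 : continuous (fun ts : I * I => ival ts.1).
  by apply: continuous_ival => us; exact: cvg_fst.
have c2 : continuous (fun ts : I * I => ival ts.2).
  by apply: continuous_ival => us; exact: cvg_snd.
split => /=.
- apply: jump_continuous => //; first by move=> ts; exact: ival_ge0.
  move=> ts; apply: (@continuous_comp _ _ _ (fun ts : I * I =>
    clamp (Num.max (2 * ival ts.1 + (- 1)) (ival ts.2)))); last exact: cts_fun.
  move: ts; apply: continuous_clamp => ts.
  apply: (@continuous_max K _ (fun ts : I * I => 2 * ival ts.1 + (- 1))) => //.
    exact: continuous_affine.
  exact: c2.
- move=> t; rewrite ival0; case: ifPn => t0.
    by rewrite /concat (eqP t0) mulr0 invr_ge0 ler0n clamp0 path_zero.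
  have t1 := ival_ge0 t; have [th|th] := lerP (ival t) 2^-1.
    rewrite /concat th max_r; last lra.
    rewrite clamp0 path_zero /= /mk_path /jump /= clamp_eq0 ifF //.
    by apply/negbTE; rewrite -ltNge mulr_gt0 // lt_neqAle eq_sym t0.
  rewrite concat_gt // max_l //; lra.
- move=> t; rewrite /mk_path /jump ival1; case: ifP => // _.
  by rewrite max_r ?clamp1 ?path_one //; have := ival_le1 t; lra.
- by move=> s; rewrite ival0 eqxx.
- move=> s; rewrite ival1 oner_eq0 max_l; last by have := ival_le1 s; lra.
  by rewrite (_ : 2 * 1 - 1 = 1) ?clamp1 ?path_one //; lra.
Qed.

Lemma step_id x (xx : specializes x x) : step xx = path_id K x.
Proof.
by apply: eq_pclass => t; rewrite /= /mk_path /jump; case: ifP.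
Qed.

Lemma step_trans x y z (xy : specializes x y) (yz : specializes y z)
  (xz : specializes x z) : path_cat (step xy) (step yz) = step xz.
Proof.
apply: step_cat => t; rewrite /= /mk_path /jump; case: ifP => _ //.
Qed.

(** Compactness of the interval in the form used below, for a property of subintervals:
    the supremum of the [b] with [P 0 b] is attained and cannot be smaller than 1. *)
Lemma interval_ind (P : K -> K -> Prop) :
  (forall a b c, 0 <= a -> a <= b -> b <= c -> c <= 1 -> P a b -> P b c -> P a c) ->
  (forall t, 0 <= t -> t <= 1 -> exists2 e, 0 < e & forall a b,
     0 <= a -> a <= t -> t <= b -> b <= 1 -> t - e < a -> b < t + e -> P a b) ->
  P 0 1.
Proof.
move=> Pcat Ploc; pose A := [set b | [/\ 0 <= b, b <= 1 & P 0 b]].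
have A0 : A 0.
  by split => //; have [//|//|e e0] := Ploc 0; apply => //; lra.
have Asup : has_sup A by split; [exists 0|exists 1 => b []].
have s0 : 0 <= sup A by apply: ub_le_sup => //; case: Asup.
have s1 : sup A <= 1 by apply: ge_sup; [exists 0|move=> b []].
have [e e0 Pe] := Ploc _ s0 s1.
have [b [b0 b1 Pb] be] := sup_adherent e0 Asup.
have bs : b <= sup A by apply: ub_le_sup; [case: Asup|split].
(* A point of [A] beyond its supremum, unless the supremum is 1. *)
pose c := Num.min 1 (sup A + e / 2).
have sc : sup A <= c by rewrite le_min s1 /=; lra.
have c1 : c <= 1 by rewrite ge_min lexx.
have ce : c < sup A + e by rewrite gt_min; apply/orP; right; lra.
have Pc : P 0 c.
  by apply: (Pcat 0 b c) => //; [exact: le_trans sc|exact: Pe].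
have : c <= sup A by apply: ub_le_sup; [case: Asup|split=> //; exact: le_trans sc].
rewrite ge_min => /orP[s1'|]; last by lra.
suff -> : 1 = c by [].
by apply/eqP; rewrite eq_le c1 andbT (le_trans s1').
Qed.

Hypothesis alexandrov : forall x, nbhs x [set y | specializes x y].

Lemma addf_continuous (T : topologicalType) (f g : T -> K) :
  continuous f -> continuous g -> continuous (fun t => f t + g t).
Proof. by move=> cf cg t; apply: (@cvgD _ K^o); [exact: cf|exact: cg]. Qed.

Lemma mulf_continuous (T : topologicalType) (f g : T -> K) :
  continuous f -> continuous g -> continuous (fun t => f t * g t).
Proof. by move=> cf cg t; apply: (@cvgM K); [exact: cf|exact: cg]. Qed.

(** Near time [t] a path stays above the point [p t], and by [step_cat] such a piece is
    a step back to [p t] followed by a step forward; [interval_ind] composes the pieces. *)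
Lemma path_class_ind (D : forall x y, pc x y -> Prop) :
  (forall x y (xy : specializes x y), D x y (step xy)) ->
  (forall x y z (a : pc x y) (b : pc y z), D _ _ a -> D _ _ b -> D _ _ (path_cat a b)) ->
  (forall x y (a : pc x y), D _ _ a -> D _ _ (path_inv a)) ->
  forall x y (a : pc x y), D _ _ a.
Proof.
move=> Dstep Dcat Dinv x y a; rewrite -(pclass_repr a); move: (repr a) => p {a}.
pose seg (a b t : K) := a + t * (b - a).
(* Quantifying over the endpoints and the path avoids rewriting in the types of paths. *)
pose P a b := forall x' y' (q : {path I from x' to y'}),
  (forall t, q t = p (clamp (seg a b (ival t)))) -> D _ _ (pclass q).
suff : P 0 1.
  by apply => t; rewrite /seg subr0 add0r mulr1 clampK.
apply: interval_ind => [a b c a0 ab bc c1 Pab Pbc|t t0 t1].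
  move=> x' z q qE.
  have cseg u v : continuous (fun t : I => p (clamp (seg u v (ival t)))).
    move=> t; apply: (@continuous_comp _ _ _ (fun t => clamp (seg u v (ival t))));
      last exact: cts_fun.
    move: t; apply: continuous_clamp.
    rewrite (_ : (fun _ => _) = fun t : I => (v - u) * ival t + u); last first.
      by apply/funext => t; rewrite /seg addrC mulrC.
    exact: continuous_ivalaffine.
  have seg0 u v : seg u v (ival (zero : I)) = u by rewrite ival0 /seg mul0r addr0.
  have seg1 u v : seg u v (ival (one : I)) = v by rewrite ival1 /seg mul1r addrC subrK.
  have q0 : p (clamp (seg a b (ival (zero : I)))) = x'.
    by rewrite -[RHS](path_zero (s := q)) qE !seg0.
  have q1 : p (clamp (seg b c (ival (one : I)))) = z.
    by rewrite -[RHS](path_one (s := q)) qE !seg1.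
  have qb u : p (clamp (seg u b (ival (one : I)))) = p (clamp b) by rewrite seg1.
  have qb' v : p (clamp (seg b v (ival (zero : I)))) = p (clamp b) by rewrite seg0.
  pose q' : {path I from x' to p (clamp b)} := mk_path (cseg a b) q0 (qb a).
  pose q'' : {path I from p (clamp b) to z} := mk_path (cseg b c) (qb' c) q1.
  suff -> : pclass q = path_cat (pclass q') (pclass q'').
    by apply: Dcat; [exact: (Pab _ _ q')|exact: (Pbc _ _ q'')].
  rewrite path_catE; apply/pclassP.
  (* The parameter of [p] run through by the concatenation: at double speed from [a] to
     [b], then from [b] to [c]. *)
  pose psi (t : I) := a + ((b - a) * Num.min (2 * ival t + 0) (0 * ival t + 1)
    + (c - b) * Num.max (0 * ival t + 0) (2 * ival t + (- 1))).
  apply: (@reparam_homotopic _ _ _ _ _ _ p (fun t => seg a c (ival t)) psi) => //.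
  - exact: cts_fun.
  - rewrite (_ : (fun _ => _) = fun t : I => (c - a) * ival t + a); last first.
      by apply/funext => t; rewrite /seg addrC mulrC.
    exact: continuous_ivalaffine.
  - rewrite /psi; apply: addf_continuous; first exact: cst_continuous.
    apply: addf_continuous; apply: mulf_continuous; try exact: cst_continuous.
      by move=> t; apply: (@continuous_min K I); exact: continuous_ivalaffine.
    by move=> t; apply: (@continuous_max K I); exact: continuous_ivalaffine.
  - by rewrite seg0 /psi ival0 min_l ?max_l; lra.
  - rewrite seg1 /psi ival1 min_r ?max_r; lra.
  - move=> t /=; rewrite /psi /concat; case: ifPn => th.
      rewrite /q' /= /mk_path; congr (p (clamp _)).
      rewrite clampE; [|have := ival_ge0 t; lra|lra].
      by rewrite min_l ?max_l /seg; lra.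
    move: th; rewrite -ltNge => th.
    rewrite /q'' /= /mk_path; congr (p (clamp _)).
    rewrite clampE; [|lra|have := ival_le1 t; lra].
    by rewrite min_r ?max_r /seg; lra.
pose z := p (clamp t).
have : \forall u \near t, specializes z (p (clamp u)).
  have cp : continuous (fun u : K => p (clamp u)).
    by apply: comp_continuous; [exact: clamp_continuous|exact: cts_fun].
  exact: (cp t _ (alexandrov z)).
move=> /nbhs_ballP[e e0 pe].
exists e => // a b a0 at_ tb b1 ta be x' y' q qE.
have zq u : specializes z (q u).
  rewrite qE; apply: pe; rewrite /ball /=.
  have u0 := ival_ge0 u; have u1 := ival_le1 u.
  rewrite ltr_distlC; apply/andP; split; rewrite /seg; nra.
have zx : specializes z x' by rewrite -(path_zero (s := q)); exact: zq.
have zy : specializes z y' by rewrite -(path_one (s := q)); exact: zq.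
rewrite -[pclass q](path_Kcat (step zx)) (step_cat zx zy) //.
by apply: Dcat => //; exact: Dinv.
Qed.

End Specialization.

Arguments specializes_refl {X} x _ _.

(** * Flat sections and holonomy *)

Section FlatSections.
Local Open Scope classical_set_scope.
Local Open Scope group_scope.
Variables (X : topologicalType) (G : groupType) (c : X -> X -> G).
Implicit Types T : topologicalType.

(** [h] is a locally constant section, over [D], of the principal bundle that has fibre [G]
    and transition functions [c], pulled back along [f]. *)
Definition flat T (D : set T) (f : T -> X) (h : T -> G) : Prop :=
  forall z, D z -> \forall z' \near z, D z' -> h z' = h z * c (f z) (f z').

Lemma flat_sub T (D D' : set T) f h : D' `<=` D -> flat D f h -> flat D' f h.
Proof. by move=> DD fl z /DD/fl; apply: filterS => z' fz' /DD. Qed.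

Lemma flat_mul T (D : set T) f h g : flat D f h -> flat D f (fun z => g * h z).
Proof. by move=> fl z Dz; apply: filterS (fl z Dz) => z' hz' /hz' ->; rewrite mulgA. Qed.

Lemma flat_comp T T' (D : set T) (u : T' -> T) f h :
  continuous u -> flat D f h -> flat (u @^-1` D) (f \o u) (h \o u).
Proof. by move=> cu fl z Dz; exact: (cu z _ (fl _ Dz)). Qed.

(** The ratio of two flat sections is locally constant, because the same factor [c] moves
    both of them. *)
Lemma flat_uniq T (D : set T) f h1 h2 z0 : connected D -> flat D f h1 -> flat D f h2 ->
  D z0 -> h1 z0 = h2 z0 -> forall z, D z -> h1 z = h2 z.
Proof.
move=> cD fl1 fl2 Dz0 h0 z Dz.
pose E := [set z | D z -> h1 z = h2 z]; pose N := [set z | D z -> h1 z <> h2 z].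
have DE : forall y, D y -> E y -> E° y.
  move=> y Dy /(_ Dy) e; rewrite /interior/=; near=> y' => Dy'.
  rewrite (near (fl1 _ Dy) y') // (near (fl2 _ Dy) y') ?e //.
have DN : forall y, D y -> N y -> N° y.
  move=> y Dy /(_ Dy) e; rewrite /interior/=; near=> y' => Dy'.
  rewrite (near (fl1 _ Dy) y') // (near (fl2 _ Dy) y') // => /mulIg; exact: e.
suff DEE : D `&` E° = D.
  by have [_ /interior_subset/(_ Dz)] : (D `&` E°) z by rewrite DEE.
apply: cD.
- by exists z0; split => //; apply: DE.
- by exists E° => //; exact: open_interior.
exists (~` N°); first by apply: open_closedC; exact: open_interior.
apply/seteqP; split => y [Dy]; last first.
  by move=> Ny; split => //; apply: DE => // _; apply: contrapT => e; exact/Ny/DN.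
by move=> /interior_subset Ey; split => // /interior_subset Ny; exact: (Ny Dy (Ey Dy)).
Unshelve. all: by end_near. Qed.

(** A constant factor on the left makes the sections agree at one point of the overlap,
    hence on all of it by [flat_uniq].  As both sets are closed, only the sections defined
    at a point matter near that point. *)
Lemma flat_glue T (D D' : set T) f h h' : closed D -> closed D' ->
  connected (D `&` D') -> D `&` D' !=set0 -> flat D f h -> flat D' f h' ->
  exists k, flat (D `|` D') f k.
Proof.
move=> cD cD' cDD' [z0 [Dz0 D'z0]] fl /(@flat_mul _ _ _ _ (h z0 / h' z0)) fl'.
have hh' : forall z, (D `&` D') z -> h z = h z0 / h' z0 * h' z.
  apply: (flat_uniq (z0 := z0) cDD') => //; last by rewrite mulgVK.
  - exact: flat_sub fl.
  - exact: flat_sub fl'.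
exists (fun z => if z \in D then h z else h z0 / h' z0 * h' z) => z Dz.
have [zD|zD] := boolP (z \in D).
  have {}zD := set_mem zD; have [zD'|zD'] := pselect (D' z).
    near=> z' => Dz'; case: ifPn => [/set_mem|] z'D.
      by rewrite (near (fl z zD) z').
    have D'z' : D' z' by case: Dz' => // Dz'; move: z'D; rewrite (mem_set Dz').
    by rewrite (near (fl' z zD') z') // -hh'.
  near=> z' => Dz'; suff z'D : D z' by rewrite mem_set // (near (fl z zD) z').
  case: Dz' => // D'z'; exfalso; move: D'z'.
  by near: z'; apply: open_nbhs_nbhs; split => //; exact: closed_openC.
have {}Dz : D' z by case: Dz => // Dz; move: zD; rewrite (mem_set Dz).
have zN : ~ D z by move=> /mem_set; apply/negP.
near=> z' => Dz'; have zN' : ~ D z'.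
  by near: z'; apply: open_nbhs_nbhs; split => //; exact: closed_openC.
rewrite ifN; last by apply/negP => /set_mem.
by rewrite (near (fl' z Dz) z') //; case: Dz'.
Unshelve. all: by end_near. Qed.

Hypothesis alexandrov : forall x : X, nbhs x [set y | specializes x y].
Hypothesis c_cocycle : forall x y z, specializes x y -> specializes y z ->
  c x z = c x y * c y z.

Lemma cocycle1 x : c x x = 1.
Proof.
have xx := specializes_refl x.
by rewrite -[LHS](mulKg (c x x)) -c_cocycle ?mulVg.
Qed.

(** Above a point [x] the cocycle itself is a flat section: this is the cocycle relation. *)
Lemma flat_star T (D : set T) f x : continuous f ->
  (forall z, D z -> specializes x (f z)) -> flat D f (fun z => c x (f z)).
Proof.
move=> cf xf z Dz; have fz : \forall z' \near z, specializes (f z) (f z').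
  exact: (cf z _ (alexandrov (f z))).
by near=> z' => Dz'; apply: c_cocycle; [exact: xf|near: z'].
Unshelve. all: by end_near.
Qed.

Section Square.
Local Open Scope ring_scope.
Variable K : realType.
Local Notation I := (unit_interval K).

Lemma setX_closed (T U : topologicalType) (A : set T) (B : set U) :
  closed A -> closed B -> closed (A `*` B).
Proof.
move=> cA cB; rewrite (_ : A `*` B = fst @^-1` A `&` snd @^-1` B) //.
apply: closedI; apply: preimage_closed => // z _.
  exact: fst_continuous.
exact: snd_continuous.
Qed.

Lemma flat_glue_fst (A A' B : set K) b (f : K * K -> X) h h' : closed A -> closed A' ->
  closed B -> A `&` A' = [set b] -> connected B -> B !=set0 ->
  flat (A `*` B) f h -> flat (A' `*` B) f h' -> exists k, flat ((A `|` A') `*` B) f k.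
Proof.
move=> cA cA' cB AA' conB [v Bv] fl fl'.
have [||||k fk] := flat_glue _ _ _ _ fl fl'; try exact: setX_closed.
- rewrite (_ : _ `&` _ = [set (b, t) | t in B]).
    apply: connected_continuous_connected => //; apply: continuous_subspaceT.
    by apply: pair_continuous; [exact: cst_continuous|move=> ?; exact: cvg_id].
  apply/seteqP; split => [[x y] [[/= Ax By] [/= A'x _]]|_ [y By <-]].
    by exists y => //; have : [set b] x by [rewrite -AA'] => /= ->.
  have [Ab A'b] : (A `&` A') b by rewrite AA'.
  by split.
- exists (b, v); have [Ab A'b] : (A `&` A') b by rewrite AA'.
  by split.
by exists k; apply: flat_sub fk => -[x y] [/= [Ax|A'x] By]; [left|right].
Qed.

Lemma flat_glue_snd (A B B' : set K) b (f : K * K -> X) h h' : closed A -> closed B ->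
  closed B' -> B `&` B' = [set b] -> connected A -> A !=set0 ->
  flat (A `*` B) f h -> flat (A `*` B') f h' -> exists k, flat (A `*` (B `|` B')) f k.
Proof.
move=> cA cB cB' BB' conA A0.
pose sw (z : K * K) := (z.2, z.1).
have csw : continuous sw.
  by apply: pair_continuous; [exact: snd_continuous|exact: fst_continuous].
have swX C C' (g : K * K -> X) k : flat (C `*` C') g k -> flat (C' `*` C) (g \o sw) (k \o sw).
  by move=> /(flat_comp csw); apply: flat_sub => z [].
move=> /swX fl /swX fl'; have [k /swX fk] := flat_glue_fst cB cB' cA BB' conA A0 fl fl'.
exists (k \o sw); move: fk; congr (flat _ _ _).
by apply/funext => -[].
Qed.

Lemma itv_glue (a b d : K) : a <= b -> b <= d ->
  (`[a, b] `|` `[b, d] = `[a, d]%classic) * (`[a, b] `&` `[b, d] = [set b]).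
Proof.
move=> ab bd; split; apply/seteqP; split => x /=; rewrite !in_itv /=.
- by case=> /andP[h h']; rewrite ?h ?h' ?andbT /=; [exact: le_trans bd|exact: le_trans h].
- by move=> /andP[-> ->]; rewrite andbT /=; apply/orP; exact: le_total.
- by case=> /andP[_ h] /andP[h' _]; apply/eqP; rewrite eq_le h h'.
- by move=> ->; rewrite ab bd lexx.
Qed.

(** Two nested uses of [interval_ind]: for a fixed height, pieces are glued along the
    horizontal direction into a section over a thin strip, then strips are stacked. *)
Lemma flat_square (f : K * K -> X) : continuous f ->
  exists h, flat (`[0, 1] `*` `[0, 1] : set (K * K)) f h.
Proof.
move=> cf; apply: (@interval_ind _ (fun u v : K =>
  exists h, flat (`[0, 1] `*` `[u, v] : set (K * K)) f h)).
  move=> a b d _ ab bd _ [h fh] [h' fh'].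
  have [<- e] := itv_glue ab bd.
  apply: (flat_glue_snd _ _ _ e _ _ fh fh'); try exact: itv_closed.
    exact: segment_connected.
  by exists 0; rewrite /= in_itv /= lexx ler01.
move=> s s0 s1; pose P (a b : K) := exists2 e : K, 0 < e &
  exists h, flat (`[a, b] `*` `[s - e, s + e] : set (K * K)) f h.
suff [e e0 [h fh]] : P 0 1.
  exists e => // a b _ _ _ _ sa sb; exists h; apply: flat_sub fh => -[x y] /= [xI].
  by rewrite !in_itv /= => /andP[ay yb]; split => //; apply/andP; split; lra.
apply: interval_ind.
  move=> a b d _ ab bd _ [e e0 [h fh]] [e' e'0 [h' fh']].
  exists (Num.min e e'); first by rewrite lt_min e0.
  have [<- eb] := itv_glue ab bd.
  have lee : Num.min e e' <= e by rewrite ge_min lexx.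
  have lee' : Num.min e e' <= e' by rewrite ge_min lexx orbT.
  have em : 0 < Num.min e e' by rewrite lt_min e0.
  apply: (flat_glue_fst (h := h) (h' := h') _ _ _ eb); try exact: itv_closed.
  - exact: segment_connected.
  - by exists s; rewrite /= in_itv /=; apply/andP; split; lra.
  - apply: flat_sub fh => -[x y] /= [xI]; rewrite !in_itv /= => /andP[ay yb].
    by split => //; apply/andP; split; lra.
  - apply: flat_sub fh' => -[x y] /= [xI]; rewrite !in_itv /= => /andP[ay yb].
    by split => //; apply/andP; split; lra.
move=> t t0 t1; have := cf (t, s) _ (alexandrov (f (t, s))).
move=> /nbhs_ballP[e e0 fe]; exists e => // a b a0 at_ tb b1 ta be.
exists (e / 2); first by rewrite divr_gt0.
exists (fun z => c (f (t, s)) (f z)); apply: flat_star => // -[x y] [/=].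
rewrite !in_itv /= => /andP[ax xb] /andP[ay yb]; apply: fe.
by split; rewrite /ball /= ltr_distlC; apply/andP; split; lra.
Qed.

Lemma flat_homotopy (H : I * I -> X) : continuous H -> exists h, flat setT H h.
Proof.
move=> cH; pose f (z : K * K) := H (clamp z.1, clamp z.2).
have cf : continuous f.
  move=> z; apply: (@continuous_comp _ _ _ (fun z : K * K => (clamp z.1, clamp z.2) : I * I));
    last exact: cH.
  move: z; apply: pair_continuous.
    by apply: continuous_clamp; exact: fst_continuous.
  by apply: continuous_clamp; exact: snd_continuous.
have [h fh] := flat_square cf.
pose u (z : I * I) := (ival z.1, ival z.2).
have cu : continuous u.
  by apply: pair_continuous; apply: continuous_ival;
    [exact: fst_continuous|exact: snd_continuous].
exists (h \o u); move/(flat_comp cu): fh.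
rewrite (_ : f \o u = H); last by apply/funext => -[t s]; rewrite /f /u /= !clampK.
apply: flat_sub => z _; rewrite /u /=.
by split; rewrite /= in_itv /= ival_ge0 ival_le1.
Qed.

Lemma flat_path (p : I -> X) : continuous p -> exists h, flat setT p h.
Proof.
move=> cp; have [] := @flat_homotopy (p \o fst).
  by apply: comp_continuous; [exact: fst_continuous|].
move=> h fh; pose u (t : I) : I * I := (t, zero).
have cu : continuous u.
  by apply: pair_continuous; [move=> ?; exact: cvg_id|exact: cst_continuous].
by exists (h \o u); have := flat_comp cu fh.
Qed.

Lemma unit_interval_connected : connected [set: I].
Proof.
rewrite (_ : [set: I] = @clamp K @` `[0, 1]).
  apply: connected_continuous_connected; first exact: segment_connected.
  by apply: continuous_subspaceT; exact: clamp_continuous.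
apply/seteqP; split => // t _; exists (ival t); rewrite ?clampK //=.
by rewrite in_itv /= ival_ge0 ival_le1.
Qed.

Local Open Scope group_scope.

(** The value at the end of the flat section that starts at 1; the default [cst 1] stands
    for paths without flat section, and continuous paths have one by [flat_path]. *)
Definition transport (p : I -> X) : G :=
  let h := xget (cst 1) [set h | flat setT p h] in (h zero)^-1 * h one.

Lemma transportE (p : I -> X) h : flat setT p h -> transport p = (h zero)^-1 * h one.
Proof.
move=> fh; rewrite /transport; set k := xget _ _.
have fk : flat setT p k by exact: (xgetI _ fh).
(* [h zero / k zero] is the constant ratio of the two sections. *)
have e : forall t, [set: I] t -> h t = h zero / k zero * k t.
  apply: (flat_uniq (z0 := zero) unit_interval_connected fh) => //.
    exact: flat_mul.
  by rewrite mulgVK.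
by rewrite (e one) // !mulgA mulVg mul1g.
Qed.

Lemma flat_cst (x : X) h : flat [set: I] (fun=> x) h -> h zero = h one.
Proof.
move=> fh; have fc : flat [set: I] (fun=> x) (fun=> h zero).
  by move=> z _; apply: filterS filterT => z' _ _; rewrite cocycle1 mulg1.
by apply/esym; apply: (flat_uniq (z0 := zero) unit_interval_connected fh fc).
Qed.

Local Notation path x y := {path I from x to y}.

(** A flat section over the square of a homotopy restricts to flat sections over all
    rows and columns, and is constant along the two columns of fixed endpoints. *)
Lemma transport_homotopic x y (p q : path x y) :
  path_homotopic p q -> transport p = transport q.
Proof.
move=> /asboolP[H [cH Hp Hq Hx Hy]]; have [h fh] := flat_homotopy cH.
have row s : flat [set: I] (fun t => H (t, s)) (fun t => h (t, s)).
  apply: (flat_comp (u := fun t => (t, s)) _ fh).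
  by apply: pair_continuous; [move=> ?; exact: cvg_id|exact: cst_continuous].
have column t : flat [set: I] (fun s => H (t, s)) (fun s => h (t, s)).
  apply: (flat_comp (u := fun s => (t, s)) _ fh).
  by apply: pair_continuous; [exact: cst_continuous|move=> ?; exact: cvg_id].
have pE : (p : I -> X) = fun t => H (t, zero) by apply/funext => t; rewrite Hp.
have qE : (q : I -> X) = fun t => H (t, one) by apply/funext => t; rewrite Hq.
rewrite pE qE (transportE (row zero)) (transportE (row one)).
have := column zero; rewrite (_ : (fun s => _) = fun=> x); last exact/funext.
move=> /flat_cst ->; have := column one.
by rewrite (_ : (fun s => _) = fun=> y); [move=> /flat_cst ->|exact/funext].
Qed.

(** A flat section along the concatenation restricts to flat sections along both halves. *)
Lemma transport_concat x y z (p : path x y) (q : path y z) :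
  transport (concat p q) = transport p * transport q.
Proof.
have [h fh] := flat_path (@cts_fun _ _ (concat p q : path x z)).
pose l (t : I) : I := clamp (2^-1 * ival t + 0)%R.
pose r (t : I) : I := clamp (2^-1 * ival t + 2^-1)%R.
have cl : continuous l by exact/continuous_clamp/continuous_ivalaffine.
have cr : continuous r by exact/continuous_clamp/continuous_ivalaffine.
have lE t : ival (l t) = (2^-1 * ival t)%R.
  by rewrite clampE addr0 //; have := ival_ge0 t; have := ival_le1 t; lra.
have rE t : ival (r t) = (2^-1 * ival t + 2^-1)%R.
  by rewrite clampE //; have := ival_ge0 t; have := ival_le1 t; lra.
have pE : (p : I -> X) = concat p q \o l.
  apply/funext => t; rewrite /= concat_le lE; last by have := ival_le1 t; lra.
  by rewrite mulrA divff // mul1r clampK.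
have qE : (q : I -> X) = concat p q \o r.
  apply/funext => t; have [t0|t0] := eqVneq (ival t) 0%R.
    rewrite /= concat_le rE t0; last by lra.
    rewrite (_ : 2 * _ = 1)%R; last by lra.
    by rewrite clamp1 path_one -[t]clampK t0 clamp0 path_zero.
  rewrite /= concat_gt rE; last by have := ival_ge0 t; lra.
  by rewrite (_ : 2 * _ - 1 = ival t)%R ?clampK //; lra.
rewrite [in transport p]pE [in transport q]qE (transportE fh).
rewrite (transportE (flat_comp cl fh)) (transportE (flat_comp cr fh)) /=.
have -> : l zero = zero by apply: ival_inj; rewrite lE ival0 mulr0.
have -> : r one = one by apply: ival_inj; rewrite rE ival1; lra.
have -> : l one = r zero by apply: ival_inj; rewrite lE rE ival0 ival1; lra.
by rewrite mulgA mulgK.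
Qed.

Definition holonomy x y (a : path_class K x y) : G := transport (repr a).

Lemma holonomyE x y (p : path x y) : holonomy (pclass p) = transport p.
Proof. by apply: transport_homotopic; exact: repr_pclass. Qed.

Lemma holonomy_cat x y z (a : path_class K x y) (b : path_class K y z) :
  holonomy (path_cat a b) = holonomy a * holonomy b.
Proof. by rewrite /path_cat holonomyE transport_concat. Qed.

Lemma holonomy1 x : holonomy (path_id K x) = 1.
Proof. by rewrite -[LHS](mulKg (holonomy (path_id K x))) -holonomy_cat path_cat1p mulVg. Qed.

Lemma holonomyV x y (a : path_class K x y) : holonomy (path_inv a) = (holonomy a)^-1.
Proof. by apply/esym/mulg1_eq; rewrite -holonomy_cat path_catpV holonomy1. Qed.

Lemma holonomy_step x y (xy : specializes x y) : holonomy (step K xy) = c x y.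
Proof.
rewrite holonomyE (transportE (h := fun t => c x (jump x y t))).
  by rewrite jump0 jump1 cocycle1 invg1 mul1g.
apply: flat_star => [|t _]; first exact: jump_cts.
by rewrite /= /mk_path /jump; case: ifP => _; [exact: specializes_refl|].
Qed.

End Square.
End FlatSections.

(** * Evaluating words of a free group *)

Section FreeGroupHom.
Local Open Scope group_scope.
Variables (S : choiceType) (H : groupType) (E : S -> H).
Implicit Types (a : letter S) (w : seq (letter S)) (x y : free_group S).

Definition eval_letter a : H := if a.2 then (E a.1)^-1 else E a.1.
Definition eval_word w : H := \prod_(a <- w) eval_letter a.

Lemma eval_letterV a : eval_letter (inv_letter a) = (eval_letter a)^-1.
Proof. by case: a => s [] /=; rewrite /eval_letter /= ?invgK. Qed.

Lemma eval_cons a w : eval_word (a :: w) = eval_letter a * eval_word w.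
Proof. by rewrite /eval_word big_cons. Qed.

Lemma eval_cat w w' : eval_word (w ++ w') = eval_word w * eval_word w'.
Proof. by rewrite /eval_word big_cat. Qed.

Lemma eval_rcons w a : eval_word (rcons w a) = eval_word w * eval_letter a.
Proof. by rewrite -cats1 eval_cat eval_cons /eval_word big_nil mulg1. Qed.

Lemma eval_inv w : eval_word (inv_word w) = (eval_word w)^-1.
Proof.
elim: w => [|a w IH]; first by rewrite /eval_word big_nil invg1.
by rewrite /inv_word /= rev_cons eval_rcons eval_letterV IH eval_cons invgM.
Qed.

Lemma eval_reduce w : eval_word (reduce w) = eval_word w.
Proof.
elim: w => //= a w IH; rewrite eval_cons -IH; case: (reduce w) => [|b u] /=.
  by rewrite eval_cons.
case: eqP => [->|_]; last by rewrite eval_cons.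
by rewrite eval_cons eval_letterV mulVKg.
Qed.

(** The universal property of the free group: the morphism that extends [E]. *)
Definition free_lift x : H := eval_word x.

Lemma free_liftM : {morph free_lift : x y / x * y}.
Proof. by move=> x y; rewrite /free_lift /= eval_reduce eval_cat. Qed.

HB.instance Definition _ :=
  isMultiplicative.Build (free_group S) H free_lift free_liftM.

End FreeGroupHom.

Section Multiplicative.
Local Open Scope group_scope.
Variables (H' H : groupType) (phi : {multiplicative H' -> H}).

(** A [{multiplicative _ -> _}] is only required to respect products; between groups,
    units and inverses follow. *)
Lemma multiplicative1 : phi 1 = 1.
Proof. by rewrite -[LHS](mulKg (phi 1)) -gmulfM mulg1 mulVg. Qed.

Lemma multiplicativeV x : phi x^-1 = (phi x)^-1.
Proof. by apply/esym/mulg1_eq; rewrite -gmulfM mulgV multiplicative1. Qed.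

End Multiplicative.

Arguments multiplicative1 {H' H} phi.

Section FreeGroupMorphism.
Local Open Scope group_scope.
Variables (S : choiceType) (H : groupType) (phi : {multiplicative free_group S -> H}).
Local Notation E := (fun s => phi (free_gen s)).

Lemma morph_letter a : phi (free_letter a) = eval_letter E a.
Proof.
case: a => s [] //; rewrite /eval_letter /= -multiplicativeV; congr (phi _).
exact: val_inj.
Qed.

Lemma morph_eval (x : free_group S) : phi x = eval_word E x.
Proof.
case: x => w wP /=; elim: w wP => [|a w IH] wP.
  rewrite /eval_word big_nil -(multiplicative1 phi); congr (phi _); exact: val_inj.
have w'P : reduced_word w by exact: path_sorted wP.
rewrite eval_cons -(IH w'P) -morph_letter -gmulfM; congr (phi _).
by apply: val_inj => /=; rewrite -[LHS](reduce_id wP) /= reduce_id.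
Qed.

End FreeGroupMorphism.

Lemma take_onth (T : Type) (w : seq T) i a :
  onth w i = Some a -> take i.+1 w = rcons (take i w) a.
Proof.
move=> wi; have iw : (i < size w)%N by rewrite -onthTE wi.
by rewrite (take_nth a iw) (onth_nth _ _ _ _ wi).
Qed.

(** * Cells, chains and the free action *)

Section PathVertices.
Local Open Scope group_scope.
Variables (S : finType) (H : groupType) (phi : {multiplicative free_group S -> H}).
Local Notation E := (fun s => phi (free_gen s)).
Implicit Type r : free_group S.

Lemma subword_recr r i : subword r 0 i.+1 = subword r 0 i * nth_letter r i.+1.
Proof. by rewrite /subword big_nat_recr. Qed.

Lemma nth_letterE r i a : onth (r : seq _) i = Some a -> nth_letter r i.+1 = free_letter a.
Proof.
move=> ri; have ir : (i < size r)%N by rewrite -onthTE ri.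
by rewrite /nth_letter /= (nth_map a) // (onth_nth _ _ _ _ ri).
Qed.

Lemma path_vertex0 g r : path_vertex phi g r 0 = g.
Proof. by rewrite /path_vertex /subword big_nat1 /nth_letter /= multiplicative1 mulg1. Qed.

Lemma path_vertexS g r i a : onth (r : seq _) i = Some a ->
  path_vertex phi g r i.+1 = path_vertex phi g r i * eval_letter E a.
Proof.
by move=> ri; rewrite /path_vertex subword_recr (nth_letterE ri) gmulfM morph_letter mulgA.
Qed.

Lemma path_vertex_take g r i : (i <= size r)%N ->
  path_vertex phi g r i = g * eval_word E (take i r).
Proof.
elim: i => [_|i IH ir]; first by rewrite path_vertex0 take0 /eval_word big_nil mulg1.
case ri : (onth (r : seq _) i) => [a|]; last by move: ir; rewrite -onthTE ri.
by rewrite (path_vertexS _ ri) (take_onth ri) eval_rcons mulgA -IH // ltnW.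
Qed.

Lemma path_vertex_size g r : path_vertex phi g r (size r) = g * phi r.
Proof. by rewrite path_vertex_take // take_size morph_eval. Qed.

End PathVertices.

Section Cells.
Local Open Scope group_scope.
Local Open Scope classical_set_scope.
Local Open Scope quotient_scope.
Context {S : finType} {G : groupType}.
Variables (R : {fset free_group S}) (phi : {multiplicative free_group S -> G}).
Local Notation cell := (@cell S G R).
Local Notation vertex := (@Vertex S G R).
Local Notation chain := (chain R phi).
Local Notation Q := (orbit_space R phi).
Implicit Types (x y : cell) (g h v w : G) (sigma tau lambda kappa : chain) (q : Q).

Definition cell_dim (x : cell) : nat :=
  match x with Vertex _ => 0%N | Edge _ _ => 1%N | Face _ _ => 2%N end.

Lemma in_boundary_dim x y : in_boundary phi x y -> (cell_dim x < cell_dim y)%N.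
Proof. by case. Qed.

Lemma cell_le_dim x y : cell_le phi x y -> cell_dim x = cell_dim y -> x = y.
Proof. by case=> // /in_boundary_dim /[swap] ->; rewrite ltnn. Qed.

Lemma cell_le_refl x : cell_le phi x x. Proof. by left. Qed.

Lemma cell_le_vertex v w : cell_le phi (vertex v) (vertex w) -> v = w.
Proof. by move=> /cell_le_dim /(_ erefl) []. Qed.

(** The ends of an edge of a face are consecutive vertices of its attaching path; an edge
    traversed backwards starts at the later one. *)
Lemma cell_le_vertex_trans v x y :
  cell_le phi (vertex v) x -> cell_le phi x y -> cell_le phi (vertex v) y.
Proof.
case=> [<- //|vx] [<-|xy]; right => //.
case: xy vx => //.
- by move=> g s; inversion 1.
- by move=> g s; inversion 1.
- by move=> g r i _; inversion 1.
- move=> g r i s ri; inversion 1; subst.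
    by apply: FaceVertex; rewrite ltnW // -onthTE ri.
  have := path_vertexS phi g ri; rewrite /eval_letter /= => <-.
  by apply: FaceVertex; rewrite -onthTE ri.
- move=> g r i s ri; inversion 1; subst.
    by apply: FaceVertex; rewrite -onthTE ri.
  rewrite (path_vertexS phi g ri) /eval_letter /= mulgVK.
  by apply: FaceVertex; rewrite ltnW // -onthTE ri.
Qed.

Lemma act_cell_dim g x : cell_dim (act_cell g x) = cell_dim x.
Proof. by case: x. Qed.

Lemma act_cell_free g x : act_cell g x = x -> g = 1.
Proof.
by case: x => [h|h s|h r] /= [e]; rewrite -(mulgK h g) e mulgV.
Qed.

(** Translation preserves dimension, and two comparable cells of equal dimension are
    equal. *)
Lemma chain_act_free g sigma x : cells sigma x -> cells sigma (act_cell g x) -> g = 1.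
Proof.
move=> sx sgx; apply: (@act_cell_free _ x).
case: (cells_total sx sgx) => /cell_le_dim; rewrite act_cell_dim => /(_ erefl) //.
Qed.

Lemma act_chainE g sigma x : cells (act_chain g sigma) (act_cell g x) <-> cells sigma x.
Proof.
split=> [[y sy e]|sx]; last by exists x.
by rewrite -(act_cell1 x) -(mulVg g) act_cellM -e -act_cellM mulVg act_cell1.
Qed.

Lemma act_chain_inv g sigma x : cells (act_chain g sigma) x <-> cells sigma (act_cell g^-1 x).
Proof.
by rewrite -(act_chainE g sigma) -act_cellM mulgV act_cell1.
Qed.

Lemma act_chain_sub g sigma tau :
  cells sigma `<=` cells tau -> cells (act_chain g sigma) `<=` cells (act_chain g tau).
Proof. exact: image_subset. Qed.

(** The orbit map is evenly covered: each orbit meets the star of [sigma] at most once,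
    and in a point with trivial stabilizer. *)
Lemma act_chain_uniq g h sigma lambda : cells sigma `<=` cells (act_chain g lambda) ->
  cells sigma `<=` cells (act_chain h lambda) -> g = h.
Proof.
move=> sg sh; have [x sx] := cells_nonempty sigma.
have /act_chain_inv lx := sg _ sx; have /act_chain_inv lx' := sh _ sx.
suff gh : h^-1 * g = 1 by rewrite -[LHS](mulVKg h) gh mulg1.
apply: (chain_act_free lx); rewrite -act_cellM -mulgA mulgV mulg1.
exact: lx'.
Qed.

End Cells.

(** * The orbit space and its deck cocycle *)

Section OrbitSpace.
Local Open Scope group_scope.
Local Open Scope classical_set_scope.
Local Open Scope quotient_scope.
Context {S : finType} {G : groupType}.
Variables (R : {fset free_group S}) (phi : {multiplicative free_group S -> G}).
Local Notation cell := (@cell S G R).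
Local Notation vertex := (@Vertex S G R).
Local Notation chain := (chain R phi).
Local Notation Q := (orbit_space R phi).
Implicit Types (x y : cell) (g h v w : G) (sigma tau lambda kappa : chain) (q : Q).

Lemma open_chainP (A : set chain) :
  open A <-> (forall sigma lambda, cells sigma `<=` cells lambda -> A sigma -> A lambda).
Proof.
split=> [[D _ <-] sigma lambda sl [tau Dt ts]|upA].
  by exists tau => //; exact: subset_trans sl.
exists A => //; apply/seteqP; split => [lambda [sigma As sl]|sigma As].
  exact: upA sl As.
by exists sigma.
Qed.

Definition orb sigma : Q := \pi_(quotient_topology {eq_quot same_orbit_equiv R phi}) sigma.

Definition orb_repr q : chain :=
  repr (q : quotient_topology {eq_quot same_orbit_equiv R phi}).

Lemma orb_reprK q : orb (orb_repr q) = q.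
Proof. exact: reprK. Qed.

Lemma orb_surj q : exists sigma, orb sigma = q.
Proof. by exists (orb_repr q); exact: orb_reprK. Qed.

Lemma orbP sigma tau : orb sigma = orb tau <-> exists g, tau = act_chain g sigma.
Proof.
split=> [/eqmodP/asboolP //|h]; apply/eqmodP; exact/asboolP.
Qed.

Lemma orb_act g sigma : orb (act_chain g sigma) = orb sigma.
Proof. by apply/esym/orbP; exists g. Qed.

Lemma orb_open (A : set Q) : open (orb @^-1` A) -> open A.
Proof. by []. Qed.

Lemma orb_continuous : continuous orb.
Proof. exact: pi_continuous. Qed.

(** The set is open because its preimage is closed under passing to larger chains: a
    translation can be undone first. *)
Lemma nbhs_orb sigma : nbhs (orb sigma)
  [set q | exists2 lambda, cells sigma `<=` cells lambda & orb lambda = q].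
Proof.
apply: open_nbhs_nbhs; split; last by exists sigma.
apply: orb_open; apply/open_chainP => lambda mu lm [tau st /orbP[g le]].
exists (act_chain g^-1 mu); last by rewrite orb_act.
apply: subset_trans st _; rewrite -[tau]act_chain1 -(mulVg g) act_chainM -le.
exact: act_chain_sub.
Qed.

Lemma specializes_orb sigma lambda :
  cells sigma `<=` cells lambda -> specializes (orb sigma) (orb lambda).
Proof.
move=> sl A /(@orb_continuous sigma A); rewrite nbhsE => -[B [oB Bs BA]].
exact: BA (proj1 (open_chainP B) oB _ _ sl Bs).
Qed.

Lemma specializesP sigma q : specializes (orb sigma) q ->
  exists2 lambda, cells sigma `<=` cells lambda & orb lambda = q.
Proof. by move=> /(_ _ (nbhs_orb sigma)). Qed.

Lemma orbit_space_alexandrov q : nbhs q [set q' | specializes q q'].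
Proof.
have [sigma <-] := orb_surj q.
apply: (@filterS _ _ (nbhs_filter (orb sigma)) _ _ _ (nbhs_orb sigma)) => _ [lambda sl <-].
exact: specializes_orb.
Qed.

Definition position sigma : G :=
  xget 1 [set g | sigma = act_chain g (orb_repr (orb sigma))].

Lemma positionP sigma : sigma = act_chain (position sigma) (orb_repr (orb sigma)).
Proof.
have /orbP[g e] := orb_reprK (orb sigma).
by have := @xgetPex _ 1 [set g | sigma = act_chain g (orb_repr (orb sigma))]; apply; exists g.
Qed.

Lemma position_act g sigma : position (act_chain g sigma) = g * position sigma.
Proof.
apply: (@act_chain_uniq _ _ _ _ _ _ (act_chain g sigma) (orb_repr (orb sigma))) => x.
  by rewrite {1}(positionP (act_chain g sigma)) orb_act.
by rewrite {1}(positionP sigma) -act_chainM.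
Qed.

(** The displacement between representatives: if [sigma] is the representative over [q]
    and [q] specializes to [q'], then [deck q q'] carries the representative
    over [q'] into the star of [sigma]. *)
Definition deck (q q' : Q) : G := xget 1 [set g | exists sigma lambda,
  [/\ cells sigma `<=` cells lambda, orb sigma = q, orb lambda = q' &
      g = (position sigma)^-1 * position lambda]].

(** By [act_chain_uniq] another pair of nested chains over the same two orbits is a
    translate of the first one by a single group element, which cancels. *)
Lemma deckE sigma lambda : cells sigma `<=` cells lambda ->
  deck (orb sigma) (orb lambda) = (position sigma)^-1 * position lambda.
Proof.
move=> sl; apply: xget_unique; first by exists sigma, lambda.
move=> _ [s' [l' [s'l' /esym/orbP[g sE] /esym/orbP[h lE] ->]]].
rewrite {}sE {}lE in s'l' *.
have ghl : cells (act_chain g sigma) `<=` cells (act_chain g lambda).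
  exact: act_chain_sub.
by rewrite !position_act (act_chain_uniq s'l' ghl) invgM -mulgA mulKg.
Qed.

Lemma deck_cocycle (x y z : Q) : specializes x y -> specializes y z ->
  deck x z = deck x y * deck y z.
Proof.
have [sigma <-] := orb_surj x => /specializesP[lambda sl <-] /specializesP[mu lm <-].
rewrite !deckE //; last exact: subset_trans lm.
by rewrite -mulgA mulVKg.
Qed.

End OrbitSpace.

(** * Spokes and turns around the base point *)

Section Via.
Variables (K : realType) (X : topologicalType).
Implicit Types x q k : X.

Definition via x q k (xk : specializes x k) (qk : specializes q k) : path_class K x q :=
  path_cat (step K xk) (path_inv (step K qk)).

Lemma via_above x q k k' (kk' : specializes k k') (xk : specializes x k)
    (qk : specializes q k) (xk' : specializes x k') (qk' : specializes q k') :
  via xk qk = via xk' qk'.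
Proof.
rewrite /via -(step_trans K xk kk' xk') -(step_trans K qk kk' qk') path_inv_cat.
by rewrite path_catA path_catK.
Qed.

Lemma via_step x q q' k (qq' : specializes q q') (xk : specializes x k)
    (qk : specializes q k) (q'k : specializes q' k) :
  path_cat (via xk qk) (step K qq') = via xk q'k.
Proof.
rewrite /via -(step_trans K qq' q'k qk) path_inv_cat -!path_catA path_catVp.
by rewrite path_catp1.
Qed.

Lemma via_self x q (xq : specializes x q) (qq : specializes q q) : via xq qq = step K xq.
Proof. by rewrite /via step_id path_inv1 path_catp1. Qed.

Lemma via_turn_eq x q q1 k k1 k' k1' (xk : specializes x k) (qk : specializes q k)
    (xk' : specializes x k') (qk' : specializes q k') (xk1 : specializes x k1)
    (qk1 : specializes q1 k1) (xk1' : specializes x k1') (qk1' : specializes q1 k1') :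
  q = q1 -> k = k1 -> k' = k1' ->
  path_cat (via xk qk) (path_inv (via xk' qk')) =
  path_cat (via xk1 qk1) (path_inv (via xk1' qk1')).
Proof.
move=> qe ke ke'; subst q1 k1 k1'.
by rewrite (Prop_irrelevance xk xk1) (Prop_irrelevance qk qk1)
  (Prop_irrelevance xk' xk1') (Prop_irrelevance qk' qk1').
Qed.

End Via.

Section Spokes.
Local Open Scope group_scope.
Local Open Scope classical_set_scope.
Context {S : finType} {G : groupType}.
Variables (K : realType) (R : {fset free_group S}) (phi : {multiplicative free_group S -> G}).
Local Notation cell := (@cell S G R).
Local Notation vertex := (@Vertex S G R).
Local Notation edge := (@Edge S G R).
Local Notation chain := (chain R phi).
Local Notation Q := (orbit_space R phi).
Local Notation genG := (fun s => phi (free_gen s)).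
Implicit Types (x y : cell) (g h v w : G) (sigma tau lambda kappa : chain) (q : Q).

Definition base : Q := orb (vertex_chain R phi).

(** Exactly the condition for [v] to be addable to [sigma]; it includes the vertex of
    [sigma] itself. *)
Definition below v sigma : Prop := forall x, cells sigma x -> cell_le phi (vertex v) x.

Lemma below_sub v sigma lambda : cells sigma `<=` cells lambda -> below v lambda -> below v sigma.
Proof. by move=> sl vl x /sl/vl. Qed.

Lemma cone_total v sigma (vs : below v sigma) :
  total_on (vertex v |` cells sigma) (cell_le phi).
Proof.
move=> x y [->|sx] [->|sy].
- by left; exact: cell_le_refl.
- by left; exact: vs.
- by right; exact: vs.
- exact: cells_total sx sy.
Qed.

Definition cone v sigma (vs : below v sigma) : chain :=
  Chain (ex_intro _ (vertex v) (or_introl erefl)) (cone_total vs).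

Lemma cone_sub v sigma (vs : below v sigma) : cells sigma `<=` cells (cone vs).
Proof. by move=> x sx; right. Qed.

Lemma base_below sigma v : cells sigma (vertex v) -> specializes base (orb sigma).
Proof.
move=> sv; rewrite /base -(orb_act v); apply: specializes_orb.
by move=> _ [_ -> <-]; rewrite /= mulg1.
Qed.

Lemma base_cone v sigma (vs : below v sigma) : specializes base (orb (cone vs)).
Proof. by apply: (@base_below _ v); left. Qed.

(** All vertices lie in one orbit, so the chains whose orbits lie above the base point are
    those that contain a vertex. *)
Lemma base_belowP sigma : specializes base (orb sigma) -> exists v, cells sigma (vertex v).
Proof.
move=> /specializesP[lambda vl /orbP[g ->]]; exists g.
by exists (vertex 1); [exact: vl|rewrite /= mulg1].
Qed.

Lemma below_vertex sigma v : cells sigma (vertex v) -> below v sigma.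
Proof.
move=> sv x sx; have [//|[->|xv]] := cells_total sv sx; first by left.
by inversion xv.
Qed.

Definition spoke v sigma (vs : below v sigma) : path_class K base (orb sigma) :=
  via K (base_cone vs) (specializes_orb (cone_sub vs)).

Lemma spoke_irr v sigma (vs vs' : below v sigma) : spoke vs = spoke vs'.
Proof. by rewrite (Prop_irrelevance vs vs'). Qed.

(** The upper bound used to define the spoke is the smallest possible one, so any other
    one lies above it and gives the same path. *)
Lemma spokeE v sigma kappa (vs : below v sigma) (bk : specializes base (orb kappa))
    (sk : specializes (orb sigma) (orb kappa)) :
  cells sigma `<=` cells kappa -> cells kappa (vertex v) -> via K bk sk = spoke vs.
Proof.
move=> sigk kv; have ck : cells (cone vs) `<=` cells kappa by move=> x /= [->|/sigk].
by apply/esym; exact: via_above (specializes_orb ck) _ _ _ _.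
Qed.

Lemma spoke_step v sigma lambda (sl : cells sigma `<=` cells lambda)
    (vs : below v sigma) (vl : below v lambda) :
  path_cat (spoke vs) (step K (specializes_orb sl)) = spoke vl.
Proof.
have sc : cells sigma `<=` cells (cone vl) by apply: subset_trans sl _; exact: cone_sub.
rewrite -(spokeE vs (base_cone vl) (specializes_orb sc)) //; last by left.
exact: via_step.
Qed.

Definition turn v w sigma (vs : below v sigma) (ws : below w sigma) : path_class K base base :=
  path_cat (spoke vs) (path_inv (spoke ws)).

(** Both spokes are prolonged by the same step, which cancels.  This is what moves a turn
    from an edge to a flag containing it and on to the face of the flag. *)
Lemma turn_sub v w sigma lambda (vs : below v sigma) (ws : below w sigma)
    (vl : below v lambda) (wl : below w lambda) :
  cells sigma `<=` cells lambda -> turn vs ws = turn vl wl.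
Proof.
move=> sl; rewrite /turn -(spoke_step sl vs vl) -(spoke_step sl ws wl).
by rewrite path_inv_cat path_catA path_catK.
Qed.

Lemma turn_cat u v w sigma (us : below u sigma) (vs : below v sigma) (ws : below w sigma) :
  path_cat (turn us vs) (turn vs ws) = turn us ws.
Proof. by rewrite /turn path_catA path_catVK. Qed.

Lemma turn_inv v w sigma (vs : below v sigma) (ws : below w sigma) :
  path_inv (turn vs ws) = turn ws vs.
Proof. by rewrite /turn path_inv_cat path_invK. Qed.

Lemma turn_id v w sigma (vs : below v sigma) (ws : below w sigma) :
  v = w -> turn vs ws = path_id K base.
Proof. by move=> vw; subst w; rewrite /turn (spoke_irr vs ws) path_catpV. Qed.

Lemma act_below g v sigma : below v sigma -> below (g * v) (act_chain g sigma).
Proof. by move=> vs _ [x sx <-]; apply: (@act_cell_le _ _ _ _ g (vertex v)); exact: vs. Qed.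

Lemma act_cone g v sigma (vs : below v sigma) (gvs : below (g * v) (act_chain g sigma)) :
  cone gvs = act_chain g (cone vs).
Proof. by apply: chain_eq; rewrite /= image_setU image_set1. Qed.

Lemma turn_act g v w sigma (vs : below v sigma) (ws : below w sigma)
    (gvs : below (g * v) (act_chain g sigma)) (gws : below (g * w) (act_chain g sigma)) :
  turn gvs gws = turn vs ws.
Proof.
by apply: via_turn_eq; rewrite ?(act_cone vs) ?(act_cone ws) orb_act.
Qed.

Lemma chain1_total x : total_on [set x] (cell_le phi).
Proof. by move=> _ _ -> ->; left; left. Qed.

Definition chain1 x : chain := Chain (ex_intro [set x] x erefl) (@chain1_total x).

Lemma chain1_act g x : act_chain g (chain1 x) = chain1 (act_cell g x).
Proof. by apply: chain_eq; rewrite /= image_set1. Qed.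

Lemma below_chain1 v x : cell_le phi (vertex v) x -> below v (chain1 x).
Proof. by move=> vx _ ->. Qed.

Lemma below_source g s : below g (chain1 (edge g s)).
Proof. by apply: below_chain1; right; exact: EdgeSource. Qed.

Lemma below_target g s : below (g * genG s) (chain1 (edge g s)).
Proof. by apply: below_chain1; right; exact: EdgeTarget. Qed.

Definition edge_loop s : path_class K base base := turn (@below_source 1 s) (@below_target 1 s).

(** Translating the edge to the identity element changes no orbit. *)
Lemma turn_edge g s (gs : below g (chain1 (edge g s)))
    (gs' : below (g * genG s) (chain1 (edge g s))) :
  turn gs gs' = edge_loop s.
Proof.
have h1 : below (g * 1) (act_chain g (chain1 (edge 1 s))).
  exact/act_below/below_source.
have h2 : below (g * (1 * genG s)) (act_chain g (chain1 (edge 1 s))).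
  exact/act_below/below_target.
rewrite /edge_loop -(turn_act _ _ h1 h2); move: h1 h2.
rewrite chain1_act /= mul1g mulg1 => h1 h2.
by rewrite /turn (spoke_irr gs h1) (spoke_irr gs' h2).
Qed.

End Spokes.

(** * Edge loops generate and relators are trivial *)

Section Spelling.
Local Open Scope group_scope.
Local Open Scope classical_set_scope.
Context {S : finType} {G : groupType}.
Variables (K : realType) (R : {fset free_group S}) (phi : {multiplicative free_group S -> G}).
Local Notation cell := (@cell S G R).
Local Notation vertex := (@Vertex S G R).
Local Notation edge := (@Edge S G R).
Local Notation face := (@Face S G R).
Local Notation chain := (chain R phi).
Local Notation Q := (orbit_space R phi).
Local Notation genG := (fun s => phi (free_gen s)).
Local Notation base := (base R phi).
Local Notation pi1 := (fundamental_group K base).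
Local Notation edge_loop := (edge_loop K R phi : S -> pi1).
Implicit Types (x y : cell) (g h v w : G) (sigma tau lambda kappa : chain) (q : Q) (r : R).

Lemma pi1_mul_path (a b : pi1) : a * b = path_cat a b. Proof. by []. Qed.
Lemma pi1_inv_path (a : pi1) : a^-1 = path_inv a. Proof. by []. Qed.

Lemma below_face g r i : (i <= size (fsval r))%N ->
  below (path_vertex phi g (fsval r) i) (chain1 phi (face g r)).
Proof. by move=> ir; apply: below_chain1; right; exact: FaceVertex. Qed.

Lemma chain2_total x y : cell_le phi x y -> total_on [set x; y] (cell_le phi).
Proof. by move=> xy _ _ [->|->] [->|->]; do ?[by left; left]; [left|right]. Qed.

Definition chain2 x y (xy : cell_le phi x y) : chain :=
  Chain (ex_intro _ x (or_introl erefl)) (chain2_total xy).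

Lemma below_chain2 v x y (xy : cell_le phi x y) :
  cell_le phi (vertex v) x -> below v (chain2 xy).
Proof. by move=> vx _ [->//|->]; exact: cell_le_vertex_trans xy. Qed.

(** Both turns equal the turn at the flag made of [x] and [y]. *)
Lemma turn_chain2 v w x y (xy : cell_le phi x y) (vx : below v (chain1 phi x))
    (wx : below w (chain1 phi x)) (vy : below v (chain1 phi y)) (wy : below w (chain1 phi y)) :
  turn K vx wx = turn K vy wy.
Proof.
have vxy : below v (chain2 xy) by apply: below_chain2; exact: vx.
have wxy : below w (chain2 xy) by apply: below_chain2; exact: wx.
rewrite (turn_sub K vx wx vxy wxy); last by move=> _ ->; left.
by rewrite (turn_sub K vy wy vxy wxy) // => _ ->; right.
Qed.

Lemma turn_edgeE v w g s (vs : below v (chain1 phi (edge g s)))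
    (ws : below w (chain1 phi (edge g s))) :
  v = g -> w = g * genG s -> turn K vs ws = edge_loop s.
Proof. by move=> ve we; subst v w; exact: turn_edge. Qed.

(** Two consecutive vertices of a face lie below their common edge. *)
Lemma turn_face_step g r i a (ir : (i <= size (fsval r))%N) (iSr : (i < size (fsval r))%N) :
  onth (fsval r : seq _) i = Some a ->
  turn K (@below_face g r _ ir) (@below_face g r _ iSr) = eval_letter edge_loop a.
Proof.
case: a => s [] ri; have := path_vertexS phi g ri; rewrite /eval_letter /= => pS.
  have ef : cell_le phi (edge (path_vertex phi g (fsval r) i.+1) s) (face g r).
    by right; exact: FaceEdgeInv.
  have pS' : path_vertex phi g (fsval r) i = path_vertex phi g (fsval r) i.+1 * genG s.
    by rewrite pS mulgVK.
  have h1 := @below_source _ _ R phi (path_vertex phi g (fsval r) i.+1) s.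
  have h2 := @below_target _ _ R phi (path_vertex phi g (fsval r) i.+1) s.
  rewrite -pS' in h2.
  rewrite pi1_inv_path -(turn_edgeE h1 h2 erefl pS') turn_inv.
  exact/esym/turn_chain2.
have ef : cell_le phi (edge (path_vertex phi g (fsval r) i) s) (face g r).
  by right; exact: FaceEdge.
have h1 := @below_source _ _ R phi (path_vertex phi g (fsval r) i) s.
have h2 := @below_target _ _ R phi (path_vertex phi g (fsval r) i) s.
rewrite -pS in h2.
rewrite -(turn_edgeE h1 h2 erefl pS).
exact/esym/turn_chain2.
Qed.

Lemma turn_face g r i (ir : (i <= size (fsval r))%N) :
  turn K (@below_face g r _ (leq0n _)) (@below_face g r _ ir) =
  eval_word edge_loop (take i (fsval r)).
Proof.
elim: i ir => [|i IH] ir.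
  by rewrite turn_id // take0 /eval_word big_nil.
case ri : (onth (fsval r : seq _) i) => [a|]; last by have := ir; rewrite -onthTE ri.
rewrite (take_onth ri) eval_rcons -(IH (ltnW ir)) pi1_mul_path.
by rewrite -(turn_face_step g (ltnW ir) ir ri) turn_cat.
Qed.

(** Reading the whole relator leads back to the starting vertex, so the turn is between
    equal vertices. *)
Lemma relator_loop r : phi (fsval r) = 1 -> eval_word edge_loop (fsval r) = 1.
Proof.
move=> r1; rewrite -[X in eval_word _ X]take_size -(turn_face 1 (leqnn _)).
by apply: turn_id; rewrite path_vertex0 path_vertex_size r1 mulg1.
Qed.

Definition spelled (a : pi1) : Prop := exists u : seq (letter S), a = eval_word edge_loop u.

Lemma spelled1 : spelled 1.
Proof. by exists [::]; rewrite /eval_word big_nil. Qed.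

Lemma spelledM a b : spelled a -> spelled b -> spelled (a * b).
Proof. by move=> [u ->] [w ->]; exists (u ++ w); rewrite eval_cat. Qed.

Lemma spelledV a : spelled a -> spelled a^-1.
Proof. by move=> [w ->]; exists (inv_word w); rewrite eval_inv. Qed.

Lemma spelled_turn_edge v w g s (vs : below v (chain1 phi (edge g s)))
  (ws : below w (chain1 phi (edge g s))) : spelled (turn K vs ws).
Proof.
have ends u : below u (chain1 phi (edge g s)) -> u = g \/ u = g * genG s.
  by move=> /(_ _ erefl)[//|us]; inversion us; [left|right].
have loop u u' (us : below u (chain1 phi (edge g s))) (us' : below u' (chain1 phi (edge g s))) :
    u = g -> u' = g * genG s -> spelled (turn K us us').
  move=> ue ue'; exists [:: (s, false)].
  by rewrite (turn_edgeE us us' ue ue') /eval_word big_seq1.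
case: (ends _ vs) (ends _ ws) => ve [] we.
- by rewrite turn_id; [exact: spelled1|rewrite ve we].
- exact: loop.
- by rewrite -turn_inv; apply: spelledV; exact: loop.
- by rewrite turn_id; [exact: spelled1|rewrite ve we].
Qed.

Lemma spelled_turn_face v w g r (vs : below v (chain1 phi (face g r)))
  (ws : below w (chain1 phi (face g r))) : spelled (turn K vs ws).
Proof.
have corner u (us : below u (chain1 phi (face g r))) :
    spelled (turn K (@below_face g r _ (leq0n _)) us).
  have [i ir ui] : exists2 i, (i <= size (fsval r))%N & u = path_vertex phi g (fsval r) i.
    by have [//|uf] := us _ erefl; inversion uf; exists i.
  subst u; rewrite /turn (spoke_irr K us (@below_face g r i ir)) -/(turn _ _ _).
  by rewrite turn_face; eexists.
rewrite -(turn_cat K vs (@below_face g r _ (leq0n _)) ws).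
by apply: spelledM => //; rewrite -turn_inv; exact: spelledV.
Qed.

(** The turn can be computed at any cell of the chain alone, by [turn_sub]. *)
Lemma spelled_turn v w sigma (vs : below v sigma) (ws : below w sigma) :
  spelled (turn K vs ws).
Proof.
have down x : cells sigma x ->
    (forall (vx : below v (chain1 phi x)) (wx : below w (chain1 phi x)),
      spelled (turn K vx wx)) -> spelled (turn K vs ws).
  move=> sx; have xs : cells (chain1 phi x) `<=` cells sigma by move=> _ ->.
  have vx := below_sub xs vs; have wx := below_sub xs ws.
  by move=> /(_ vx wx); rewrite (turn_sub K vx wx vs ws).
have [[g|g s|g r] sx] := cells_nonempty sigma; apply: (down _ sx) => vx wx.
- rewrite turn_id; first exact: spelled1.
  by rewrite (cell_le_vertex (vx _ erefl)) (cell_le_vertex (wx _ erefl)).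
- exact: spelled_turn_edge.
- exact: spelled_turn_face.
Qed.

Lemma spelled_via q (k k' : Q) (bk : specializes base k) (qk : specializes q k)
    (bk' : specializes base k') (qk' : specializes q k') :
  spelled (path_cat (via K bk qk) (path_inv (via K bk' qk'))).
Proof.
have [sigma sq] := orb_surj q; subst q.
have [kappa sk ke] := specializesP qk; have [kappa' sk' ke'] := specializesP qk'.
subst k k'; have [v kv] := base_belowP bk; have [v' kv'] := base_belowP bk'.
have vs := below_sub sk (below_vertex kv); have v's := below_sub sk' (below_vertex kv').
by rewrite (spokeE K vs) // (spokeE K v's) //; exact: spelled_turn.
Qed.

(** A vertex of the lowest-dimensional cell of a chain lies below the whole chain. *)
Lemma base_reach q : exists k, specializes base k /\ specializes q k.
Proof.
have [sigma <-] := orb_surj q.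
have [v vs] : exists v, below v sigma.
  have min x : cells sigma x -> (forall y, cells sigma y -> cell_le phi x y) ->
      exists v, below v sigma.
    move=> sx xmin; have [v vx] : exists v, cell_le phi (vertex v) x.
      case: x {sx xmin} => [g|g s|g r]; exists g; first by left.
        by right; exact: EdgeSource.
      by right; rewrite -{1}(path_vertex0 phi g (fsval r)); exact: FaceVertex.
    by exists v => y /xmin; exact: cell_le_vertex_trans.
  have dimmin x : cells sigma x ->
      (forall y, cells sigma y -> (cell_dim x <= cell_dim y)%N) ->
      exists v, below v sigma.
    move=> sx xmin; apply: (min x sx) => y sy.
    have [//|[->|/in_boundary_dim]] := cells_total sx sy; first by left.
    by rewrite ltnNge xmin.
  have [x0 sx0] := cells_nonempty sigma.
  have dimP : exists n, `[< exists2 x, cells sigma x & cell_dim x = n >].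
    by exists (cell_dim x0); apply/asboolP; exists x0.
  case: (ex_minnP dimP) => n /asboolP[x sx xn] nmin.
  apply: (dimmin x sx) => y sy; rewrite xn; apply: nmin.
  by apply/asboolP; exists y.
by exists (orb (cone vs)); split; [exact: base_cone|apply: specializes_orb; exact: cone_sub].
Qed.

(** The induction over the groupoid needs a property of paths with arbitrary endpoints:
    closing the path up to the base point, through whatever upper bounds, gives a spelled
    loop.  For a single step this is [spelled_via], since its target's upper bounds also
    bound its source. *)
Lemma all_spelled (a : pi1) : spelled a.
Proof.
pose D (q q' : Q) (b : path_class K q q') := forall k k' (bk : specializes base k)
  (qk : specializes q k) (bk' : specializes base k') (qk' : specializes q' k'),
  spelled (path_cat (path_cat (via K bk qk) b) (path_inv (via K bk' qk'))).
have bb : specializes base base by exact: specializes_refl.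
suff : D _ _ a.
  by move=> /(_ _ _ bb bb bb bb); rewrite via_self step_id path_inv1 path_catp1 path_cat1p.
apply: path_class_ind.
- exact: orbit_space_alexandrov.
- move=> q q' qq' k k' bk qk bk' qk'.
  have qk1 := specializes_trans qq' qk'.
  rewrite -(via_step K qq' bk' qk1 qk') path_inv_cat path_catA path_catK.
  exact: spelled_via.
- move=> q q' q'' {}a b Da Db k k' bk qk bk' qk'.
  have [l [bl ql]] := base_reach q'.
  have := spelledM (Da _ _ bk qk bl ql) (Db _ _ bl ql bk' qk').
  by rewrite pi1_mul_path; move: (via _ _ _) (via _ _ _) (via _ _ _) => u u' u'';
    rewrite !path_catA path_catVK.
- move=> q q' {}a Da k k' bk qk bk' qk'.
  have := spelledV (Da _ _ bk' qk' bk qk).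
  by move: (via _ _ _) (via _ _ _) => u u'; rewrite pi1_inv_path !path_inv_cat path_invK path_catA.
Qed.

End Spelling.

(** * The isomorphism *)

Lemma isomorphic_of_morphism (G H : groupType) (f : H -> G) :
  {morph f : x y / (x * y)%g} -> bijective f -> isomorphic G H.
Proof.
move=> fM [f' fK f'K].
have f'M : {morph f' : x y / (x * y)%g}.
  by move=> x y; apply: (can_inj fK); rewrite fM !f'K.
pose f'm := isMultiplicative.Build G H f' f'M.
pose F : {multiplicative G -> H} := HB.pack f' f'm.
by exists F; exists f.
Qed.

Section Isomorphism.
Local Open Scope group_scope.
Local Open Scope classical_set_scope.
Context {S : finType} {G : groupType}.
Variables (K : realType) (R : {fset free_group S}) (phi : {multiplicative free_group S -> G}).
Local Notation Q := (orbit_space R phi).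
Local Notation genG := (fun s => phi (free_gen s)).
Local Notation base := (base R phi).
Local Notation pi1 := (fundamental_group K base).
Local Notation edge_loop := (edge_loop K R phi : S -> pi1).
Local Notation hol := (holonomy (@deck S G R phi)).
Local Notation pos1 := (position (vertex_chain R phi)).
Implicit Types (g h v w : G) (sigma : chain R phi) (q : Q).

Let alex := @orbit_space_alexandrov S G R phi.
Let coc := @deck_cocycle S G R phi.

Lemma holonomy_spoke v sigma (vs : below v sigma) :
  hol (spoke K vs) = (v * pos1)^-1 * position sigma.
Proof.
rewrite /spoke /via (holonomy_cat alex coc) (holonomyV alex coc) !(holonomy_step alex coc).
rewrite deckE; last exact: cone_sub.
have vc : cells (act_chain v (vertex_chain R phi)) `<=` cells (cone vs).
  by move=> _ [_ -> <-]; left; rewrite /= mulg1.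
by rewrite /base -(orb_act v) (deckE vc) position_act !invgM invgK -!mulgA mulVKg.
Qed.

(** The representative of the vertex orbit is some vertex, perhaps not 1; its position
    accounts for the conjugation. *)
Lemma holonomy_turn v w sigma (vs : below v sigma) (ws : below w sigma) :
  hol (turn K vs ws) = (v^-1 * w) ^ pos1.
Proof.
rewrite /turn (holonomy_cat alex coc) (holonomyV alex coc) !holonomy_spoke.
by rewrite /conjg !invgM !invgK -!mulgA mulVKg.
Qed.

Lemma holonomy_edge_loop s : hol (edge_loop s) = genG s ^ pos1.
Proof. by rewrite holonomy_turn invg1 !mul1g. Qed.

Lemma holonomy_word (u : seq (letter S)) :
  hol (eval_word edge_loop u) = eval_word genG u ^ pos1.
Proof.
elim: u => [|[s b] u IH].
  by rewrite /eval_word !big_nil conj1g (holonomy1 alex coc).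
rewrite !eval_cons conjMg -IH (holonomy_cat alex coc); congr (_ * _).
rewrite /eval_letter /=; case: b; last exact: holonomy_edge_loop.
by rewrite (holonomyV alex coc) holonomy_edge_loop conjVg.
Qed.

Lemma kernel_normal (H : groupType) (f : {multiplicative free_group S -> H}) :
  normal_subgroup [set x | f x = 1].
Proof.
split => /=.
- exact: multiplicative1.
- by move=> x y fx fy; rewrite gmulfM fx fy mulg1.
- by move=> x fx; rewrite multiplicativeV fx invg1.
- by move=> x y fx; rewrite /conjg !gmulfM multiplicativeV fx mul1g mulVg.
Qed.

Hypothesis presR : is_presentation R phi.

Lemma relator_trivial r : r \in R -> phi r = 1.
Proof.
move=> rR; have [_ kerE] := presR.
suff : [set w | phi w = 1] r by [].
by rewrite kerE => N [_]; apply.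
Qed.

(** The words that spell trivial loops form a normal subgroup containing the relators,
    hence containing the kernel of [phi]. *)
Lemma word_loop_trivial (u : seq (letter S)) :
  eval_word genG u = 1 -> eval_word edge_loop u = 1.
Proof.
move=> u1; pose x := FreeGroup (reduce_reduced u).
have [_ kerE] := presR.
have : [set w | phi w = 1] x by rewrite /= morph_eval /= eval_reduce.
rewrite kerE => /(_ [set y | free_lift edge_loop y = 1]) /=.
rewrite /free_lift /= eval_reduce; apply; split.
  exact: (kernel_normal (free_lift edge_loop : {multiplicative free_group S -> pi1})).
by move=> r rR; exact: (relator_loop K (r := [` rR]%fset) (relator_trivial rR)).
Qed.

Lemma holonomy_base_inj (a : pi1) : hol a = 1 -> a = 1.
Proof.
have [u ->] := all_spelled a; rewrite holonomy_word => /eqP; rewrite conjg_eq1 => /eqP.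
exact: word_loop_trivial.
Qed.

Lemma holonomy_base_surj g : exists a : pi1, hol a = g.
Proof.
have [surj _] := presR.
have : range phi (g ^ pos1^-1) by rewrite surj.
by move=> [x _ xg]; exists (eval_word edge_loop x); rewrite holonomy_word -morph_eval xg conjgKV.
Qed.

(** Holonomy is an isomorphism at the base point; a path from there to [q] transfers this
    to [q], and the inverse goes from [G] to the fundamental group. *)
Lemma orbit_space_pi1 q : isomorphic G (fundamental_group K q).
Proof.
have [k [bk qk]] := base_reach q; have t : path_class K base q := via K bk qk.
have holM : {morph (fun a : fundamental_group K q => hol a) : a b / a * b}.
  by move=> a b; exact: (holonomy_cat alex coc).
apply: (isomorphic_of_morphism holM).
rewrite -setTT_bijective; split => //.
- move=> a b _ _ /= hab; apply: divg1_eq.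
  have dE : path_cat (path_cat t (path_cat a (path_inv b))) (path_inv t) = path_id K base.
    apply: holonomy_base_inj; rewrite !(holonomy_cat alex coc) !(holonomyV alex coc).
    by rewrite hab mulgV mulg1 mulgV.
  have : path_cat (path_cat (path_inv t)
      (path_cat (path_cat t (path_cat a (path_inv b))) (path_inv t))) t = path_id K q.
    by rewrite dE path_catp1 path_catVp.
  rewrite -!path_catA path_catVp path_catp1 path_Kcat; exact.
- move=> g _; have [a ag] := holonomy_base_surj (hol t * g / hol t).
  exists (path_cat (path_cat (path_inv t) a) t) => //.
  by rewrite !(holonomy_cat alex coc) (holonomyV alex coc) ag; move: (holonomy _ t) => u;
    rewrite -!mulgA mulVg mulg1 mulKg.
Qed.

End Isomorphism.

(** * Counting the orbits *)

Section Cardinality.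
Local Open Scope group_scope.
Local Open Scope classical_set_scope.
Context {S : finType} {G : groupType}.
Variables (R : {fset free_group S}) (phi : {multiplicative free_group S -> G}).
Local Notation cell := (@cell S G R).
Local Notation vertex := (@Vertex S G R).
Local Notation edge := (@Edge S G R).
Local Notation face := (@Face S G R).
Local Notation chain := (chain R phi).
Local Notation Q := (orbit_space R phi).
Local Notation genG := (fun s => phi (free_gen s)).
Implicit Types (x y : cell) (g h v w : G) (s : S) (sigma tau lambda kappa : chain) (q : Q) (r : R).

(** A chain has at most one vertex, one edge and one face, and is recorded by them. *)
Definition shape : Type := (option G * option (G * S) * option (G * R))%type.

Definition shape_cells (p : shape) : set cell := [set x | match x with
  | Vertex v => p.1.1 = Some v
  | Edge g s => p.1.2 = Some (g, s)
  | Face g r => p.2 = Some (g, r)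
  end].

Definition act_shape g (p : shape) : shape :=
  (omap (fun v => g * v) p.1.1, omap (fun e => (g * e.1, e.2)) p.1.2,
   omap (fun f => (g * f.1, f.2)) p.2).

Lemma act_shape_cells g p : act_cell g @` shape_cells p = shape_cells (act_shape g p).
Proof.
case: p => [[ov oe] off]; apply/seteqP; split => [_ [[v|h s|h r] /= + <-] /=|[v|h s|h r]] /=.
- by move=> ->.
- by move=> ->.
- by move=> ->.
- by case: ov => // v' [<-]; exists (vertex v').
- by case: oe => // -[g' s'] [<- <-]; exists (edge g' s').
- by case: off => // -[g' r'] [<- <-]; exists (face g' r').
Qed.

Lemma shape_cells_inj : injective shape_cells.
Proof.
move=> [[ov oe] off] [[ov' oe'] off'] e.
have ee x : shape_cells (ov, oe, off) x <-> shape_cells (ov', oe', off') x by rewrite e.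
have opt (T : Type) (a b : option T) : (forall t, a = Some t <-> b = Some t) -> a = b.
  case: a => [a|] ab; first by apply/esym/ab.
  by case: b ab => // b ab; apply/ab.
congr (_, _, _); apply: opt.
- by move=> v; exact: (ee (vertex v)).
- by move=> [g s]; exact: (ee (edge g s)).
- by move=> [g r]; exact: (ee (face g r)).
Qed.

Lemma chain_dim_uniq sigma x y : cells sigma x -> cells sigma y ->
  cell_dim x = cell_dim y -> x = y.
Proof.
move=> sx sy xy; have [h|h] := cells_total sx sy; first exact: cell_le_dim h xy.
by apply/esym; exact: cell_le_dim h (esym xy).
Qed.

Lemma chain_shape sigma : exists p, cells sigma = shape_cells p.
Proof.
have pick (T : Type) (f : T -> cell) :
    (forall t t', cells sigma (f t) -> cells sigma (f t') -> t = t') ->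
    exists o : option T, forall t, cells sigma (f t) <-> o = Some t.
  move=> inj; have [[t st]|nt] := pselect (exists t, cells sigma (f t)).
    by exists (Some t) => t'; split=> [st'|[<-]//]; rewrite (inj _ _ st st').
  by exists None => t; split=> // st; case: nt; exists t.
have [|ov ovP] := pick G vertex.
  by move=> v w sv sw; have [] := chain_dim_uniq sv sw erefl.
have [|oe oeP] := pick (G * S)%type (fun e => edge e.1 e.2).
  by move=> [g s] [g' s'] sv sw; have [/= -> ->] := chain_dim_uniq sv sw erefl.
have [|off ofP] := pick (G * R)%type (fun e => face e.1 e.2).
  by move=> [g s] [g' s'] sv sw; have [/= -> ->] := chain_dim_uniq sv sw erefl.
exists (ov, oe, off); apply/seteqP; split=> -[v|g s|g r] /=.
- by move/ovP.
- by move=> /(oeP (g, s)).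
- by move=> /(ofP (g, r)).
- by move/ovP.
- by move=> /(oeP (g, s)).
- by move=> /(ofP (g, r)).
Qed.

(** The base point of the cell of highest dimension: the quantity that is normalized to 1
    to pick one chain per orbit. *)
Definition anchor (p : shape) : G :=
  if p.2 is Some f then f.1 else if p.1.2 is Some e then e.1
  else if p.1.1 is Some v then v else 1.

Lemma anchor_act g p : shape_cells p !=set0 -> anchor (act_shape g p) = g * anchor p.
Proof.
by case: p => [[[v|] [e|]] [f|]] //=; case=> -[].
Qed.

Definition corner r i : G := path_vertex phi 1 (fsval r) i.
Definition letter_at r (i : 'I_(size (fsval r))) : letter S := tnth (in_tuple (fsval r)) i.
(** As a cell, an edge traversed backwards is based at the end of the traversal. *)
Definition side r (i : 'I_(size (fsval r))) : G * S :=
  (corner r (i + (letter_at i).2), (letter_at i).1).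

(** The orbits of chains: the vertex; an edge, alone or with its source ([false]) or
    target ([true]); a face, alone or at a position [i] of its boundary with the vertex
    [i] ([None]), with the edge [i] ([Some None]), or with this edge and its endpoint
    [i + b] ([Some (Some b)]). *)
Definition code : Type := (unit + S * option bool +
  {r : R & option ('I_(size (fsval r)) * option (option bool))})%type.

Definition code_shape (c : code) : shape :=
  match c with
  | inl (inl _) => (Some 1, None, None)
  | inl (inr (s, None)) => (None, Some (1, s), None)
  | inl (inr (s, Some b)) => (Some (if b then genG s else 1), Some (1, s), None)
  | inr (existT r None) => (None, None, Some (1, r))
  | inr (existT r (Some (i, None))) => (Some (corner r i), None, Some (1, r))
  | inr (existT r (Some (i, Some None))) => (None, Some (side i), Some (1, r))
  | inr (existT r (Some (i, Some (Some b)))) =>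
      (Some (corner r (i + b)), Some (side i), Some (1, r))
  end.

Lemma anchor_code c : anchor (code_shape c) = 1.
Proof. by case: c => [[[]|[s [b|]]]|[r [[i [[b|]|]]|]]]. Qed.

Lemma onth_letter r (i : 'I_(size (fsval r))) : onth (fsval r : seq _) i = Some (letter_at i).
Proof.
rewrite onthE (nth_map (letter_at i)) // /letter_at; congr Some.
by rewrite -(tnth_nth _ (in_tuple (fsval r))).
Qed.

Lemma corner_step r (i : 'I_(size (fsval r))) :
  corner r i.+1 = corner r i * eval_letter genG (letter_at i).
Proof. exact: (path_vertexS phi 1 (onth_letter i)). Qed.

Lemma side_target r (i : 'I_(size (fsval r))) :
  (side i).1 * genG (side i).2 = corner r (i + ~~ (letter_at i).2).
Proof.
rewrite /side /=; have := corner_step i; rewrite /eval_letter.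
by case: (letter_at i).2; rewrite /= ?addn1 addn0 => ->; rewrite ?mulgVK.
Qed.

Lemma side_boundary r (i : 'I_(size (fsval r))) :
  in_boundary phi (edge (side i).1 (side i).2) (face 1 r).
Proof.
rewrite /side /=; have := onth_letter i.
case: (letter_at i) => s [] /= ri; rewrite ?addn1 ?addn0.
  exact: FaceEdgeInv.
exact: FaceEdge.
Qed.

Lemma side_end r (i : 'I_(size (fsval r))) (b : bool) :
  in_boundary phi (vertex (corner r (i + b))) (edge (side i).1 (side i).2).
Proof.
have [->|nb] := eqVneq b (letter_at i).2; first exact: EdgeSource.
have -> : b = ~~ (letter_at i).2 by case: b (letter_at i).2 nb => [] [].
by rewrite -side_target; exact: EdgeTarget.
Qed.

Lemma corner_boundary r i : (i <= size (fsval r))%N ->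
  in_boundary phi (vertex (corner r i)) (face 1 r).
Proof. exact: FaceVertex. Qed.

Lemma corner_boundaryP r v : in_boundary phi (vertex v) (face 1 r) ->
  exists2 i, (i <= size (fsval r))%N & v = corner r i.
Proof. by move=> vf; inversion vf; exists i. Qed.

Lemma side_boundaryP r g s : in_boundary phi (edge g s) (face 1 r) ->
  exists i : 'I_(size (fsval r)), (g, s) = side i.
Proof.
move=> ef; have [i [a ri e]] : exists i, exists2 a, onth (fsval r : seq _) i = Some a &
    (g, s) = (corner r (i + a.2), a.1).
  inversion ef; subst.
    by exists i, (s, false); rewrite //= addn0.
  by exists i, (s, true); rewrite //= addn1.
have ir : (i < size (fsval r))%N by rewrite -onthTE ri.
exists (Ordinal ir); rewrite e /side.
by have := onth_letter (Ordinal ir); rewrite /= ri => -[->].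
Qed.

Lemma side_endP r (i : 'I_(size (fsval r))) v :
  in_boundary phi (vertex v) (edge (side i).1 (side i).2) -> exists b : bool, v = corner r (i + b).
Proof.
move=> vE; have [->|->] : v = (side i).1 \/ v = (side i).1 * genG (side i).2.
  by inversion vE; [left|right].
- by exists (letter_at i).2.
- by rewrite side_target; exists (~~ (letter_at i).2).
Qed.

Lemma shape_total p :
  (forall v g s, p.1.1 = Some v -> p.1.2 = Some (g, s) -> in_boundary phi (vertex v) (edge g s)) ->
  (forall v g r, p.1.1 = Some v -> p.2 = Some (g, r) -> in_boundary phi (vertex v) (face g r)) ->
  (forall h s g r, p.1.2 = Some (h, s) -> p.2 = Some (g, r) ->
     in_boundary phi (edge h s) (face g r)) ->
  total_on (shape_cells p) (cell_le phi).
Proof.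
case: p => [[ov oe] off] /= ve vf ef [v|g s|g r] [v'|g' s'|g' r'] /= px py.
- by left; left; move: px; rewrite py => -[->].
- by left; right; exact: ve.
- by left; right; exact: vf.
- by right; right; exact: ve.
- by left; left; move: px; rewrite py => -[-> ->].
- by left; right; exact: ef.
- by right; right; exact: vf.
- by right; right; exact: ef.
- by left; left; move: px; rewrite py => -[-> ->].
Qed.

Lemma code_total c : total_on (shape_cells (code_shape c)) (cell_le phi).
Proof.
case: c => [[[]|[s [b|]]]|[r [[i [[b|]|]]|]]]; apply: shape_total => //=.
- move=> v g s' [<-] [<- <-]; case: b; last exact: EdgeSource.
  by rewrite -[genG s]mul1g; exact: EdgeTarget.
- by move=> v g s [<-] /(@Some_inj _ _ _) e; have := side_end i b; rewrite e.
- move=> v g r' [<-] [<- <-]; apply: corner_boundary.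
  by case: b; rewrite ?addn0 ?addn1 // ltnW.
- by move=> h s g r' /(@Some_inj _ _ _) e [<- <-]; have := side_boundary i; rewrite e.
- by move=> h s g r' /(@Some_inj _ _ _) e [<- <-]; have := side_boundary i; rewrite e.
- by move=> v g r' [<-] [<- <-]; apply: corner_boundary; rewrite ltnW.
Qed.

Lemma code_nonempty c : shape_cells (code_shape c) !=set0.
Proof.
case: c => [[[]|[s [b|]]]|[r [[i [[b|]|]]|]]] /=;
  solve [by exists (vertex 1) | by exists (edge 1 s) | by exists (face 1 r)].
Qed.

Definition code_chain c : chain := Chain (code_nonempty c) (@code_total c).

Lemma total_in_boundary (A : set cell) x y : total_on A (cell_le phi) -> A x -> A y ->
  (cell_dim x < cell_dim y)%N -> in_boundary phi x y.
Proof.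
move=> At Ax Ay xy; have [[e|//]|[e|/in_boundary_dim]] := At _ _ Ax Ay.
- by rewrite e ltnn in xy.
- by rewrite e ltnn in xy.
- by rewrite ltnNge ltnW.
Qed.

Hypothesis relator_gt0 : forall r, (0 < size (fsval r))%N.
Hypothesis relator1 : forall r, phi (fsval r) = 1.

Lemma corner_size r : corner r (size (fsval r)) = corner r 0.
Proof. by rewrite /corner path_vertex_size path_vertex0 relator1 mulg1. Qed.

(** The last vertex of the boundary path is the first one again. *)
Lemma corner_ord r i : (i <= size (fsval r))%N ->
  exists j : 'I_(size (fsval r)), corner r i = corner r j.
Proof.
rewrite leq_eqVlt => /predU1P[->|ir]; last by exists (Ordinal ir).
by exists (Ordinal (relator_gt0 r)); rewrite corner_size.
Qed.

Lemma shape_code p : total_on (shape_cells p) (cell_le phi) -> shape_cells p !=set0 ->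
  anchor p = 1 -> exists c, p = code_shape c.
Proof.
move=> pt p0.
have ve v g s : p.1.1 = Some v -> p.1.2 = Some (g, s) -> in_boundary phi (vertex v) (edge g s).
  by move=> pv pe; apply: (total_in_boundary pt).
have vf v g r : p.1.1 = Some v -> p.2 = Some (g, r) -> in_boundary phi (vertex v) (face g r).
  by move=> pv pf; apply: (total_in_boundary pt).
have ef h s g r : p.1.2 = Some (h, s) -> p.2 = Some (g, r) -> in_boundary phi (edge h s) (face g r).
  by move=> pe pf; apply: (total_in_boundary pt).
case: p p0 ve vf ef {pt} => [[ov oe] [[g r]|]] /= p0 ve vf ef; rewrite /anchor /=.
  move=> g1; subst g.
  case: oe p0 ve ef => [[h s]|] p0 ve ef.
    have [i ei] := side_boundaryP (ef _ _ _ _ erefl erefl).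
    case: ov {p0 vf} ve => [v|] ve; last first.
      by exists (inr (existT _ r (Some (i, Some None)))); rewrite ei.
    have := ve _ _ _ erefl erefl; rewrite -[h]/(h, s).1 -{2}[s]/(h, s).2 ei => /side_endP[b ->].
    by exists (inr (existT _ r (Some (i, Some (Some b))))).
  case: ov vf {p0 ve} => [v|] vf; last by exists (inr (existT _ r None)).
  have [i ir ->] := corner_boundaryP (vf _ _ _ erefl erefl).
  have [j ->] := corner_ord ir.
  by exists (inr (existT _ r (Some (j, None)))).
case: oe p0 ve {ef} => [[h s]|] p0 ve.
  move=> /= h1; subst h; case: ov ve {p0 vf} => [v|] ve; last by exists (inl (inr (s, None))).
  have {}ve := ve _ _ _ erefl erefl.
  have [->|->] : v = 1 \/ v = genG s by inversion ve; rewrite ?mul1g; [left|right].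
    by exists (inl (inr (s, Some false))).
  by exists (inl (inr (s, Some true))).
case: ov p0 {ve vf} => [v|] p0; last by case: p0 => -[].
by move=> /= ->; exists (inl (inl tt)).
Qed.

Lemma code_chain_surj q : exists c, orb (code_chain c) = q.
Proof.
have [sigma <-] := orb_surj q; have [p sp] := chain_shape sigma.
have p0 : shape_cells p !=set0 by rewrite -sp; exact: cells_nonempty.
have := anchor_act (anchor p)^-1 p0; rewrite mulVg.
have := cells_nonempty (act_chain (anchor p)^-1 sigma).
have := @cells_total _ _ _ _ (act_chain (anchor p)^-1 sigma).
rewrite /= sp act_shape_cells => /shape_code cP /cP{}cP /cP[c pc].
exists c; rewrite -[RHS](orb_act (anchor p)^-1); congr (orb _); apply: chain_eq.
by rewrite /= sp act_shape_cells pc.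
Qed.

Hypothesis redR : is_reduced_presentation R phi.

(** Two equal vertices of the boundary path enclose a subword that is trivial in [G], and a
    reduced presentation allows this only for the whole relator. *)
Lemma corner_uniq r i j : (i < j)%N -> (j <= size (fsval r))%N ->
  corner r i = corner r j -> i = 0%N /\ j = size (fsval r).
Proof.
move=> ij jr /mulgI.
have -> : subword (fsval r) 0 j = subword (fsval r) 0 i * subword (fsval r) i.+1 j.
  by rewrite /subword (big_cat_nat (n := i.+1)) // ltnS ltnW.
rewrite gmulfM => /esym ijE; have ij1 : phi (subword (fsval r) i.+1 j) = 1.
  by rewrite -[LHS](mulKg (phi (subword (fsval r) 0 i))) ijE mulVg.
have [_ red] := redR.
have ijr : (i.+1 <= j <= size (fsval r))%N by rewrite ij jr.
have ij0 : (i.+1, j) <> (0%N, 0%N) by case.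
by have [[//|[->]] ->] := red _ i.+1 j (fsvalP r) ijr ij0 ij1.
Qed.

Lemma corner_inj r i j : (i < size (fsval r))%N -> (j < size (fsval r))%N ->
  corner r i = corner r j -> i = j.
Proof.
move=> ir jr cij; have [ij|ji|//] := ltngtP i j.
  by have [_ jE] := corner_uniq ij (ltnW jr) cij; rewrite jE ltnn in jr.
by have [_ iE] := corner_uniq ji (ltnW ir) (esym cij); rewrite iE ltnn in ir.
Qed.

Lemma corner_neq r (i : 'I_(size (fsval r))) : corner r i <> corner r i.+1.
Proof.
rewrite corner_step => e; have l1 : eval_letter genG (letter_at i) = 1.
  by rewrite -[LHS](mulKg (corner r i)) -e mulVg.
have [gen1 _] := redR; apply: (gen1 (letter_at i).1).
by move: l1; rewrite /eval_letter; case: ifP => // _ /eqP; rewrite invg_eq1 => /eqP.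
Qed.

Lemma end_inj r (i : 'I_(size (fsval r))) (b b' : bool) :
  corner r (i + b) = corner r (i + b') -> b = b'.
Proof.
case: b b' => [] [] //; rewrite addn0 addn1 => /esym; first by move=> /corner_neq.
by move/esym => /corner_neq.
Qed.

Lemma letter_not_inv r (i j : 'I_(size (fsval r))) : j = i.+1 :> nat ->
  letter_at j <> inv_letter (letter_at i).
Proof.
move=> ji e; have := fwordP (fsval r); rewrite /reduced_word.
move=> /(sortedP (letter_at i))/(_ i); rewrite -ji => /(_ (ltn_ord j)).
by rewrite -!(tnth_nth _ (in_tuple (fsval r))) -/(letter_at i) -/(letter_at j) e eqxx.
Qed.

(** If two sides traverse the same edge in the same direction, their sources are equal
    vertices.  In opposite directions, both pairs of crossed endpoints coincide, which by
    [corner_uniq] forces the sides to be consecutive, and then the relator would contain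
    a letter next to its inverse. *)
Lemma side_inj r (i j : 'I_(size (fsval r))) : side i = side j -> i = j.
Proof.
wlog ij : i j / (i <= j)%N.
  by move=> wl; have [/wl//|/ltnW/wl h /esym/h] := leqP i j.
move: ij; rewrite leq_eqVlt => /predU1P[/val_inj//|ij] eij.
have tE : corner r (i + ~~ (letter_at i).2) = corner r (j + ~~ (letter_at j).2).
  by rewrite -!side_target eij.
have [sE lE] : corner r (i + (letter_at i).2) = corner r (j + (letter_at j).2) /\
    (letter_at i).1 = (letter_at j).1 by case: eij.
have jr := ltn_ord j; have same : (letter_at i).2 <> (letter_at j).2.
  move=> e; rewrite e in sE tE.
  have [] := @corner_uniq r (i + false) (j + false).
  - by rewrite !addn0.
  - by rewrite addn0 ltnW.
  - by move: sE tE; case: (letter_at j).2.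
  - by move=> _; rewrite addn0 => jE; rewrite jE ltnn in jr.
have [e1 e2] : corner r i = corner r j.+1 /\ corner r i.+1 = corner r j.
  by move: sE tE same; case: (letter_at i).2 (letter_at j).2 => [] [] //;
    rewrite !addn1 !addn0 => e e' _; split.
have ji : j = i.+1 :> nat.
  apply/eqP; rewrite eqn_leq ij andbT leqNgt; apply/negP => iSj.
  by have [] := corner_uniq iSj (ltnW jr) e2.
exfalso; apply: (letter_not_inv ji); rewrite /inv_letter lE.
by case: (letter_at j) same => s b /=; case: (letter_at i) => _ b' /=; case: b b' => [] [].
Qed.

Lemma code_shape_inj : injective code_shape.
Proof.
move=> [[[]|[s [b|]]]|[r [[i [[b|]|]]|]]] [[[]|[s' [b'|]]]|[r' [[i' [[b'|]|]]|]]] //=.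
- case=> e se; subst s'; suff -> : b = b' by [].
  by have [gen1 _] := redR; case: b b' e => [] [] // /[dup] => [|/esym] /gen1.
- by case=> ->.
- move=> e; have re : r = r' by case: e.
  subst r'; have /(@Some_inj _ _ _)/side_inj ii := congr1 (fun p : shape => p.1.2) e.
  by subst i'; have /(@Some_inj _ _ _)/end_inj -> := congr1 (fun p : shape => p.1.1) e.
- move=> e; have re : r = r' by case: e.
  subst r'; have /(@Some_inj _ _ _)/side_inj ii := congr1 (fun p : shape => p.1.2) e.
  by subst i'.
- move=> e; have re : r = r' by case: e.
  subst r'; have /(@Some_inj _ _ _) := congr1 (fun p : shape => p.1.1) e.
  by move=> /(corner_inj (ltn_ord i) (ltn_ord i'))/val_inj ->.
- by case=> ->.
Qed.

(** A translation between two coded chains fixes the anchor, so it is trivial. *)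
Lemma code_orb_inj : injective (fun c => orb (code_chain c)).
Proof.
move=> c c' /orbP[g e]; apply: code_shape_inj.
have {}e : shape_cells (code_shape c') = shape_cells (act_shape g (code_shape c)).
  by rewrite -act_shape_cells -[LHS]/(cells (code_chain c')) e.
move/shape_cells_inj: e => e; have g1 : g = 1.
  have := anchor_act g (code_nonempty c); rewrite -e !anchor_code mulg1 => <- //.
apply: shape_cells_inj; rewrite e g1 -act_shape_cells.
by under eq_imagel do rewrite act_cell1; rewrite image_id.
Qed.

Lemma card_code : #|{: code}| = (1 + 3 * #|S| + \sum_(r <- R) (4 * size r + 1))%N.
Proof.
rewrite !card_sum card_unit card_prod !card_option card_bool mulnC; congr (_ + _ + _)%N.
rewrite card_tagged sumnE big_map big_enum /= big_seq_fsetE /=.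
by apply: eq_bigr => r _; rewrite card_option card_prod card_ord !card_option card_bool mulnC addn1.
Qed.

Lemma orbit_space_card : ([set: Q] #= `I_(#|{: code}|))%card.
Proof.
have [f fP] : exists f : Q -> code, forall q, orb (code_chain (f q)) = q.
  by have [f] := choice code_chain_surj; exists f.
apply/card_set_bijP; exists (fun q => enum_rank (f q) : nat); split.
- by move=> q _ /=; exact: ltn_ord.
- by move=> q q' _ _ /val_inj/enum_rank_inj ff; rewrite -(fP q) ff fP.
- move=> n /= nc; exists (orb (code_chain (enum_val (Ordinal nc)))) => //.
  by rewrite (code_orb_inj (fP _)) enum_valK.
Qed.

End Cardinality.

Local Open Scope classical_set_scope.

Theorem theorem3p6 (K : realType) (S : finType) (G : groupType)
    (R : {fset free_group S}) (phi : {multiplicative free_group S -> G}) :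
  (0 < #|S|)%N ->
  is_presentation R phi ->
  is_reduced_presentation R phi ->
  (forall r : free_group S, r \in R -> (0 < size r)%N) ->
  (forall x : orbit_space R phi, isomorphic G (fundamental_group K x)) /\
  ([set: orbit_space R phi] #=
    `I_(1 + 3 * #|S| + \sum_(r <- R) (4 * size r + 1)))%card.
Proof.
move=> _ presR redR R_gt0; split; first exact: orbit_space_pi1.
have rel_gt0 (r : R) : (0 < size (fsval r))%N by apply: R_gt0; exact: fsvalP.
have rel1 (r : R) : phi (fsval r) = 1%g by apply: (relator_trivial presR); exact: fsvalP.
by rewrite -(card_code R); exact: (orbit_space_card rel_gt0 rel1 redR).
Qed.
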